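(* Let $L_j$ be a jump Lévy basis on $\mathbb{R}^2$ with Lévy measure $l$, given by $$L_j(B)=\int_B\int_{(-1,1)}y\,\mathrm{d}(N-\nu)(\mathbf{z},y)+\int_B\int_{\mathbb{R}\setminus(-1,1)}y\,\mathrm{d}N(\mathbf{z},y),$$ and for $\epsilon\in(0,1)$ let $$L_j^\epsilon(B)=\int_B\int_{(-1,-\epsilon)\cup(\epsilon,1)}y\,\mathrm{d}(N-\nu)(\mathbf{z},y)+\int_B\int_{\mathbb{R}\setminus(-1,1)}y\,\mathrm{d}N(\mathbf{z},y).$$ Let $A=\{(s,x):s<0,\ 0<x<\phi(s)\}$ with $\phi:(-\infty,0]\to[0,\infty)$ continuous, increasing and $\int_{-\infty}^0\phi<\infty$ (bounded or unbounded), $A_t=A+(t,0)$, $X_t=L_j(A_t)$ and $X^\epsilon_t=L^\epsilon_j(A_t)$. Then (for càdlàg versions of these processes) for every sequence $\epsilon_n\downarrow0$, almost surely $\sup_{t\in[0,T]}|X^{\epsilon_n}_t-X_t|\to0$ for every $T>0$; i.e. $X^\epsilon$ converges to $X$ uniformly on compacts in the space of càdlàg paths as $\epsilon\to0$. The same holds if a Gaussian Lévy basis part $L_g(A_t)$ (independent of $N$) is added to both $X$ and $X^\epsilon$.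
   Context: $N$ is a Poisson random measure on $\mathbb{R}^2\times\mathbb{R}$ with intensity $\nu=\mathrm{Leb}\otimes l$, where $\mathrm{Leb}$ is Lebesgue measure on $\mathbb{R}^2$ and $l$ is a Lévy measure on $\mathbb{R}$ ($l(\{0\})=0$, $\int\min(1,y^2)\,l(\mathrm{d}y)<\infty$); $\mathbf{z}=(t,x)$ denotes the space-time location of a jump and $y$ its size. A Gaussian Lévy basis $L_g$ with parameters $(\xi,a)$ is an independently scattered, additive family with $L_g(B)\sim\mathcal{N}(\xi\,\mathrm{Leb}(B),a\,\mathrm{Leb}(B))$. *)

(* Defs.v *)
From HB Require Import structures.
From mathcomp Require Import all_boot all_order all_algebra.
From mathcomp Require Import all_classical all_reals all_analysis measurable_realfun.
Set Implicit Arguments. Unset Strict Implicit. Unset Printing Implicit Defensive.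
Import Order.TTheory GRing.Theory Num.Theory.
Import numFieldNormedType.Exports.
Local Open Scope classical_set_scope.
Local Open Scope ring_scope.

(* Space-time points z = (t, x) live in R * R; marked points (z, y) in (R*R)*R. *)

Definition leb2 {R : realType} : set (R * R) -> \bar R :=
  (@lebesgue_measure R \x @lebesgue_measure R)%E.

Definition levy_intensity {R : realType} (l : set R -> \bar R)
  : set ((R * R) * R) -> \bar R := (leb2 \x l)%E.

Definition levy_measure {R : realType} (l : {measure set R -> \bar R}) : Prop :=
  l [set 0] = 0%E /\ (\int[l]_y (Num.min 1 (y ^+ 2))%:E < +oo)%E.

Definition poisson_random_measure {R : realType} {d : measure_display}
  {Omega : measurableType d} (P : probability Omega R)
  {dS : measure_display} {S : measurableType dS} (nu : set S -> \bar R)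
  (N : Omega -> {measure set S -> \bar R}) : Prop :=
  (forall D, measurable D -> measurable_fun setT (fun w => N w D)) /\
  (forall D, measurable D -> (nu D < +oo)%E -> forall k : nat,
      P [set w | N w D = (k%:R)%:E] =
      (expR (- fine (nu D)) * fine (nu D) ^+ k / (k`!)%:R)%:E) /\
  (forall D, measurable D -> nu D = +oo%E -> P [set w | N w D = +oo%E] = 1%E) /\
  (forall (n : nat) (D : 'I_n -> set S) (U : 'I_n -> set (\bar R)),
      (forall i, measurable (D i)) -> (forall i, measurable (U i)) ->
      (forall i j, i != j -> D i `&` D j = set0) ->
      P [set w | forall i, U i (N w (D i))] =
      (\prod_(i < n) P [set w | U i (N w (D i))])%E).

Definition gaussian_law {R : realType} (m v : R) : set R -> \bar R :=
  fun U => if v == 0 then \d_m U else normal_prob m (Num.sqrt v) U.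

Definition gaussian_levy_basis {R : realType} {d : measure_display}
  {Omega : measurableType d} (P : probability Omega R) (xi a : R)
  (Lg : set (R * R) -> Omega -> R) : Prop :=
  0 <= a /\
  (forall B, measurable B -> (leb2 B < +oo)%E -> measurable_fun setT (Lg B)) /\
  (forall B, measurable B -> (leb2 B < +oo)%E -> forall U : set R, measurable U ->
      P (Lg B @^-1` U) = gaussian_law (xi * fine (leb2 B)) (a * fine (leb2 B)) U) /\
  (forall B C, measurable B -> measurable C -> (leb2 B < +oo)%E ->
      (leb2 C < +oo)%E -> B `&` C = set0 ->
      {ae P, forall w, Lg (B `|` C) w = Lg B w + Lg C w}) /\
  (forall (n : nat) (B : 'I_n -> set (R * R)) (U : 'I_n -> set R),
      (forall i, measurable (B i) /\ (leb2 (B i) < +oo)%E) ->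
      (forall i, measurable (U i)) ->
      (forall i j, i != j -> B i `&` B j = set0) ->
      P [set w | forall i, U i (Lg (B i) w)] =
      (\prod_(i < n) P [set w | U i (Lg (B i) w)])%E).

(** Lg is independent of N (independence of the generated sigma-algebras,
    expressed on the generating pi-systems of finite-dimensional events). *)
Definition independent_of_prm {R : realType} {d : measure_display}
  {Omega : measurableType d} (P : probability Omega R)
  {dS : measure_display} {S : measurableType dS}
  (Lg : set (R * R) -> Omega -> R) (N : Omega -> {measure set S -> \bar R}) : Prop :=
  forall (n m : nat) (B : 'I_n -> set (R * R)) (U : 'I_n -> set R)
         (D : 'I_m -> set S) (V : 'I_m -> set (\bar R)),
    (forall i, [/\ measurable (B i), (leb2 (B i) < +oo)%E & measurable (U i)]) ->
    (forall j, measurable (D j) /\ measurable (V j)) ->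
    P ([set w | forall i, U i (Lg (B i) w)] `&` [set w | forall j, V j (N w (D j))]) =
    (P [set w | forall i, U i (Lg (B i) w)] * P [set w | forall j, V j (N w (D j))])%E.

Definition small_jumps {R : realType} (eps : R) : set R := [set y | eps < `|y| < 1].
Definition big_jumps {R : realType} : set R := [set y | 1 <= `|y|].

(** L_j^eps(B) = int_B int_{(-1,-eps)u(eps,1)} y d(N - nu) + int_B int_{R\(-1,1)} y dN,
    the first integral being  int y dN - int y dnu  (finite a.s. for eps > 0). *)
Definition Lj_eps {R : realType} {d : measure_display} {Omega : measurableType d}
  (nu : set ((R * R) * R) -> \bar R) (N : Omega -> {measure set ((R * R) * R) -> \bar R})
  (eps : R) (B : set (R * R)) (w : Omega) : \bar R :=
  (\int[N w]_(p in B `*` small_jumps eps) (p.2)%:E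
   - \int[nu]_(p in B `*` small_jumps eps) (p.2)%:E
   + \int[N w]_(p in B `*` big_jumps) (p.2)%:E)%E.

(** Y is (a version of) L_j(B): the compensated small-jump integral
    int_B int_{(-1,1)} y d(N - nu) is the L^2(P)-limit of the eps-truncated
    compensated integrals as eps -> 0+, i.e.
    E |Y - L_j^eps(B)|^2 -> 0 as eps -> 0+. *)
Definition is_Lj {R : realType} {d : measure_display} {Omega : measurableType d}
  (P : probability Omega R)
  (nu : set ((R * R) * R) -> \bar R) (N : Omega -> {measure set ((R * R) * R) -> \bar R})
  (B : set (R * R)) (Y : Omega -> R) : Prop :=
  measurable_fun setT Y /\
  ((fun eps : R => (\int[P]_w ((`| (Y w)%:E - Lj_eps nu N eps B w |) ^+ 2))%E)
     @ (0 : R)^'+ --> 0%E).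

Definition ambit_set {R : realType} (phi : R -> R) (t : R) : set (R * R) :=
  [set z | z.1 < t /\ 0 < z.2 < phi (z.1 - t)].

Definition cadlag {R : realType} (f : R -> R) : Prop :=
  forall t, f x @[x --> t^'+] --> f t /\ cvg (f x @[x --> t^'-]).

Definition as_ucp_along {R : realType} {d : measure_display} {Omega : measurableType d}
  (P : probability Omega R) (X : R -> Omega -> R) (Xe : R -> R -> Omega -> R)
  (e : nat -> R) : Prop :=
  {ae P, forall w, forall T : R, 0 < T ->
     (fun n => ereal_sup [set (`| Xe (e n) t w - X t w |)%:E | t in [set t | 0 <= t <= T]])
       @ \oo --> 0%E}.

(* Main.v *)
Require Import Defs.
From HB Require Import structures.
From mathcomp Require Import all_boot all_order all_algebra.
From mathcomp Require Import all_classical all_reals all_analysis measurable_realfun.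
From mathcomp Require Import finmap ring lra.
Set Implicit Arguments. Unset Strict Implicit. Unset Printing Implicit Defensive.
Import Order.TTheory GRing.Theory Num.Theory.
Import numFieldNormedType.Exports.
Local Open Scope classical_set_scope.
Local Open Scope ring_scope.

(* For t >= 0 write A_t = E_t \ O_t, where E_t contains A_s for all 0 <= s <= t and O_t
   consists of the points which have left by time t; both families increase with t.
   Splitting y into y+ and y-, it is enough to control compensated integrals of bounded
   nonnegative functions over E_t x {e_m < |y| < 1} and over O_t x {e_m < |y| < 1}.  Over
   disjoint regions these are independent, and their variance is at most the integral of y^2
   against the intensity.  Etemadi's inequality (with its factor 3) is applied along the
   increasing dyadic times, then along the truncation index m, and Chebyshev's inequality bounds
   the probability of an oscillation beyond level n by a multiple of
   Leb(E_T) * int_{|y| <= e_n} y^2 dl, which tends to 0.  As a supremum over increasing events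
   this holds for all dyadic times and all m >= n at once, so the truncated fields are almost
   surely uniformly Cauchy over dyadic times.  The big jumps and the Gaussian part cancel in
   differences, the L^2 limit identifies X at dyadic times through an almost sure cluster point,
   and right-continuity extends the estimate to all t in [0, T]. *)

(** The obstacle is a supremum over two parameters at once, time and truncation, for a field that is
    known at each fixed time only as an [L^2] limit. Etemadi's inequality suits it because it needs
    just tail bounds and the independence of the past from the remaining increment, and because it
    holds for the maximum norm of a vector as well as for single variables. In its second use, one
    step in the truncation index therefore carries a whole row of grid times, and the two factors
    compound to [3 * 3 = 9]. The resulting bound involves only the total mass at the final time, not
    the size of the grid, so it survives refinement. Independence of past and increment is a matter
    of disjoint regions, which is why monotone families are needed in both parameters. Nonnegative
    integrands serve a second purpose: one increasing sequence of simple functions approximates the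
    integral against [nu] and against every [N w]. *)

(** Writing [(k - x)^2 = k(k - 1) + (1 - 2x) k + x^2] produces partial exponential sums shifted by
    two, one and zero indices. Their second difference leaves two boundary terms, which vanish in
    the limit. *)
Lemma poisson_central_partial_sum (R : realType) (x : R) (m : nat) :
  \sum_(0 <= k < m.+2) (k%:R - x) ^+ 2 * (x ^+ k / k`!%:R) =
  x * (\sum_(0 <= k < m.+1) x ^+ k / k`!%:R)
  - x ^+ 2 * (x ^+ m / m`!%:R - x ^+ m.+1 / m.+1`!%:R).
Proof.
elim: m => [|m IH].
  rewrite !big_nat_recr//= !big_geq//= !factS fact0 !expr0 !expr1 !mulr1n.
  by field.
rewrite big_nat_recr// IH [in RHS]big_nat_recr//=.
have f1 : (m.+1)`!%:R != 0 :> R by rewrite pnatr_eq0 -lt0n fact_gt0.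
have f2 : m`!%:R != 0 :> R by rewrite pnatr_eq0 -lt0n fact_gt0.
rewrite (factS m.+1) (factS m) !natrM !exprS.
set S := \sum_(0 <= k < m.+1) _.
have m1 : m.+1%:R = m%:R + 1 :> R by rewrite -natr1.
have m2 : m.+2%:R = m%:R + 2 :> R by rewrite -natr1 -natr1 -addrA.
rewrite m2 m1.
have mge : 0 <= m%:R :> R by rewrite ler0n.
by field; apply/and3P; split=> //; apply: lt0r_neq0; lra.
Qed.

Lemma poisson_variance_series (R : realType) (x : R) :
  (\sum_(0 <= k < n) (k%:R - x) ^+ 2 * (expR (- x) * x ^+ k / k`!%:R)) @[n --> \oo] --> x.
Proof.
pose p k := x ^+ k / k`!%:R.
have cp : series p @ \oo --> expR x.
  exact: is_cvg_series_exp_coeff.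
have p0 : p @ \oo --> (0 : R) by apply: cvg_series_cvg_0; apply/cvg_ex; exists (expR x).
rewrite -(cvg_shiftn 2) /=.
have -> : (fun n => \sum_(0 <= k < (n + 2)%N) (k%:R - x) ^+ 2 * (expR (- x) * x ^+ k / k`!%:R))
   = (fun n => expR (- x) * (x * series p n.+1 - x ^+ 2 * (p n - p n.+1))).
  apply/funext => n; rewrite addn2 /series /= -poisson_central_partial_sum mulr_sumr.
  by apply: eq_bigr => i _; rewrite -[_ * _ / _]mulrA mulrCA.
have xE : expR (- x) * (x * expR x - x ^+ 2 * (0 - 0)) = x.
  by rewrite subrr mulr0 subr0 mulrCA expRN mulVf ?mulr1// gt_eqF ?expR_gt0.
suff : (fun n => expR (- x) * (x * series p n.+1 - x ^+ 2 * (p n - p n.+1))) @ \oo -->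
    expR (- x) * (x * expR x - x ^+ 2 * (0 - 0)) by rewrite xE.
apply: cvgMl_tmp; apply: cvgB.
  by apply: cvgMl_tmp; rewrite (cvg_shiftS (series p)).
by apply: cvgMl_tmp; apply: cvgB => //; rewrite (cvg_shiftS p).
Qed.

(** * Moments of compensated counts and integrals *)

Section counting_moments.
Context (R : realType) (d : measure_display) (Omega : measurableType d).
Variables (P : probability Omega R) (dS : measure_display) (S : measurableType dS).
Variables (nu : {measure set S -> \bar R}) (N : Omega -> {measure set S -> \bar R}).
Hypothesis prmN : poisson_random_measure P nu N.

(** [fine] sends an infinite count to [0]; this occurs only on a null event when [nu D] is
    finite. *)
Definition compensated (D : set S) (w : Omega) : R := fine (N w D) - fine (nu D).

Lemma measurable_count D : measurable D -> measurable_fun setT (fun w => N w D).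
Proof. by case: prmN => + _; apply. Qed.

Lemma measurable_count_eq D (r : \bar R) :
  measurable D -> measurable [set w | N w D = r].
Proof.
move=> mD; have := measurable_count mD measurableT (emeasurable_set1 r).
by rewrite setTI.
Qed.

Lemma measurable_compensated D : measurable D -> measurable_fun setT (compensated D).
Proof.
move=> mD; apply: measurable_funB => //.
by apply: (measurableT_comp (@fine_measurable R _ measurableT)) => //; exact: measurable_count.
Qed.

(** Integer values are not part of the definition of the random measure: they follow because the
    Poisson weights add up to [1]. *)
Lemma count_ae_nat D : measurable D -> (nu D < +oo)%E ->
  P (\bigcup_k [set w | N w D = (k%:R)%:E]) = 1%E.
Proof.
move=> mD nuD.
have mA k : measurable [set w | N w D = (k%:R : R)%:E].
  exact: measurable_count_eq.
rewrite measure_bigcup//; last first.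
  by move=> i j _ _ [w [/= -> []]] /eqP; rewrite eqr_nat => /eqP.
set x := fine (nu D).
rewrite (eq_eseriesr (g := fun k => (expR (- x) * (x ^+ k / k`!%:R))%:E)); last first.
  by move=> k _; have [_ [h _]] := prmN; apply: etrans (h _ mD nuD k) _; rewrite mulrA.
apply/cvg_lim => //.
rewrite (_ : (fun n => _) = EFin \o (fun n => expR (- x) * series (exp_coeff x) n)); last first.
  apply/funext => n /=; rewrite sumEFin /series /= mulr_sumr; congr EFin.
  by apply: eq_bigl => i; rewrite in_setT.
suff h : (fun n => expR (- x) * series (exp_coeff x) n) @ \oo --> (1 : R) by apply: (cvg_comp _ _ h).
have xE : expR (- x) * expR x = 1 by rewrite expRN mulVf// gt_eqF ?expR_gt0.
suff : (fun n => expR (- x) * series (exp_coeff x) n) @ \oo --> expR (- x) * expR x by rewrite xE.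
by apply: cvgMl_tmp; exact: is_cvg_series_exp_coeff.
Qed.

Lemma count_ae_fin D : measurable D -> (nu D < +oo)%E ->
  {ae P, forall w, N w D \is a fin_num}.
Proof.
move=> mD nuD; exists (~` \bigcup_k [set w | N w D = (k%:R : R)%:E]).
have mA : measurable (\bigcup_k [set w | N w D = (k%:R : R)%:E]).
  apply: bigcup_measurable => k _.
  exact: measurable_count_eq.
split; first exact: measurableC.
  by rewrite [LHS]probability_setC// count_ae_nat// subee.
by apply: subsetC => w [k _ /= ->].
Qed.

Lemma integral_compensated_sqr D : measurable D -> (nu D < +oo)%E ->
  (\int[P]_w ((compensated D w) ^+ 2)%:E = nu D)%E.
Proof.
move=> mD nuD.
set F := fun k => [set w | N w D = (k%:R : R)%:E].
have mF k : measurable (F k).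
  exact: measurable_count_eq.
have tF : trivIset setT F.
  by move=> i j _ _ [w []]; rewrite /F/= => -> [] /eqP; rewrite eqr_nat => /eqP.
have mA : measurable (\bigcup_k F k) by exact: bigcup_measurable.
have mf : measurable_fun setT (fun w => ((compensated D w) ^+ 2)%:E).
  by apply/measurable_EFinP; apply: measurable_funX; exact: measurable_compensated.
rewrite (@ge0_negligible_integral _ _ _ _ _ (~` \bigcup_k F k))//; last 3 first.
- exact: measurableC.
- by move=> w _; rewrite lee_fin sqr_ge0.
- by rewrite [LHS]probability_setC// count_ae_nat// subee.
rewrite setTD setCK ge0_integral_bigcup//; last 2 first.
- exact: measurable_funTS.
- by move=> w _; rewrite lee_fin sqr_ge0.
set x := fine (nu D).
rewrite (eq_eseriesr (g := fun k => ((k%:R - x) ^+ 2 * (expR (- x) * x ^+ k / k`!%:R))%:E)); last first.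
  move=> k _; rewrite (eq_integral (fun=> ((k%:R - x) ^+ 2)%:E)); last first.
    by move=> w /set_mem; rewrite /compensated /F/= => ->.
  have [_ [h _]] := prmN.
  rewrite integral_cst// [RHS]EFinM; congr (_ * _)%E; exact: h.
have -> : nu D = x%:E by rewrite /x fineK// ge0_fin_numE.
apply/cvg_lim => //.
rewrite (_ : (fun n => _) = EFin \o (fun n =>
  \sum_(0 <= k < n) (k%:R - x) ^+ 2 * (expR (- x) * x ^+ k / k`!%:R))); last first.
  by apply/funext => n /=; rewrite sumEFin; congr EFin; apply: eq_bigl.
apply: cvg_EFin; first exact: nearW.
exact: poisson_variance_series.
Qed.

Lemma integrable_compensatedM D D' : measurable D -> measurable D' ->
  (nu D < +oo)%E -> (nu D' < +oo)%E ->
  P.-integrable setT (fun w => (compensated D w * compensated D' w)%:E).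
Proof.
move=> mD mD' nuD nuD'.
have i2 E : measurable E -> (nu E < +oo)%E ->
    P.-integrable setT (fun w => ((compensated E w) ^+ 2)%:E).
  move=> mE nuE; apply/integrableP; split.
    by apply/measurable_EFinP; apply: measurable_funX; exact: measurable_compensated.
  under eq_integral do rewrite gee0_abs ?lee_fin ?sqr_ge0//.
  by rewrite integral_compensated_sqr.
apply: (le_integrable _ _ _ (integrableD _ (i2 _ mD nuD) (i2 _ mD' nuD'))) => //.
  by apply/measurable_EFinP; apply: measurable_funM; exact: measurable_compensated.
move=> w _ /=; rewrite lee_fin normrM.
have := sqr_ge0 (`|compensated D w| - `|compensated D' w|).
rewrite sqrrB !real_normK ?num_real// => h.
rewrite (ger0_norm (addr_ge0 (sqr_ge0 _) (sqr_ge0 _))).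
have := mulr_ge0 (normr_ge0 (compensated D w)) (normr_ge0 (compensated D' w)).
lra.
Qed.

(** Polarisation: comparing the variance formula on [D], on [D'] and on their union forces the cross
    term to vanish. *)
Lemma integral_compensatedM_disjoint D D' : measurable D -> measurable D' ->
  (nu D < +oo)%E -> (nu D' < +oo)%E -> D `&` D' = set0 ->
  (\int[P]_w (compensated D w * compensated D' w)%:E = 0)%E.
Proof.
move=> mD mD' nuD nuD' DD'.
have mU : measurable (D `|` D') by exact: measurableU.
have nuU : (nu (D `|` D') < +oo)%E by rewrite measureU// lte_add_pinfty.
have nuE : (nu (D `|` D') = nu D + nu D')%E by exact: measureU.
have := integral_compensated_sqr mU nuU; rewrite nuE.
rewrite (ae_eq_integral (fun w => (compensated D w * compensated D w
   + compensated D' w * compensated D' w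
   + 2 * (compensated D w * compensated D' w))%:E))//; last 3 first.
- by apply/measurable_EFinP; apply: measurable_funX; exact: measurable_compensated.
- apply/measurable_EFinP; apply: measurable_funD; first by
    apply: measurable_funD; apply: measurable_funM; exact: measurable_compensated.
  by apply: measurable_funM => //; apply: measurable_funM; exact: measurable_compensated.
- apply: filterS2 (count_ae_fin mD nuD) (count_ae_fin mD' nuD') => w f1 f2 _.
  rewrite /compensated !measureU// !fineD//; first last.
    by rewrite ge0_fin_numE.
    by rewrite ge0_fin_numE.
  by congr EFin; ring.
under eq_integral do rewrite EFinD EFinD (EFinM 2).
rewrite integralD//; last 2 first.
- by apply: integrableD => //; exact: integrable_compensatedM.
- by apply: integrableZl => //; exact: integrable_compensatedM.
rewrite integralD//; [|exact: integrable_compensatedM..].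
rewrite integralZl//; last exact: integrable_compensatedM.
under eq_integral do rewrite -expr2.
rewrite integral_compensated_sqr//.
under eq_integral do rewrite -expr2.
rewrite integral_compensated_sqr//.
have fc := integrable_fin_num measurableT (integrable_compensatedM mD mD' nuD nuD').
move: fc; set I := (\int[P]_w _)%E => /fineK <-.
move: (fine I) => r; clear I.
have : nu D \is a fin_num by rewrite ge0_fin_numE.
have : nu D' \is a fin_num by rewrite ge0_fin_numE.
move: (nu D) (nu D') => [a||] [b||] // _ _.
by rewrite -EFinM -!EFinD => -[] h; congr EFin; lra.
Qed.

End counting_moments.

(** * Simple-function approximation of integrals against a varying measure *)

Section simple_integral.
Import HBNNSimple.
Context d (T : measurableType d) (R : realType).

(** [F] is kept general for two uses: the identity, for integrals of simple functions, and the
    square, for the variances of their compensated integrals. *)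
Lemma integral_comp_nnsfun (mu : {measure set T -> \bar R}) (H : set T)
    (h : {nnsfun T >-> R}) (F : R -> R) : measurable H ->
  (forall r, 0 <= r -> 0 <= F r) ->
  (\int[mu]_(x in H) (F (h x))%:E =
   \sum_(r <- fset_set (range h)) (F r)%:E * mu (H `&` h @^-1` [set r]))%E.
Proof.
move=> mH F0; set s := fset_set (range h).
have mD r : measurable (H `&` h @^-1` [set r]) by apply: measurableI.
have HE : H = \big[setU/set0]_(r <- s) (H `&` h @^-1` [set r]).
  rewrite -bigcup_seq; apply/seteqP; split=> [x Hx|x [r _ []]//].
  exists (h x) => //=; by rewrite in_fset_set//; apply/mem_set; exists x.
rewrite [in LHS]HE ge0_integral_bigsetU//; last 3 first.
- by move=> r r' _ _ [x [[_ /= <-] [_ /= <-]]].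
- rewrite -HE (_ : (fun x => _) =
    (fun x => \sum_(r <- s) (F r * \1_(h @^-1` [set r]) x)%:E)%E).
    apply: emeasurable_sum => r; apply/measurable_EFinP.
    by apply: measurable_funM => //; exact: measurable_indic.
  apply/funext => x; rewrite (big_fsetD1 (h x))/=; last first.
    by rewrite in_fset_set//; apply/mem_set; exists x.
  rewrite big_seq big1 ?adde0; first by rewrite indicE mem_set// mulr1.
  move=> r; rewrite !inE => /andP[/eqP rx _].
  by rewrite indicE memNset ?mulr0//= => /esym.
- by move=> x _; rewrite lee_fin F0.
apply: eq_bigr => r _; rewrite -integral_cst//.
by apply: eq_integral => x /set_mem[_ /= ->].
Qed.

Lemma integral_nnsfun_sum (mu : {measure set T -> \bar R}) (H : set T)
    (h : {nnsfun T >-> R}) : measurable H ->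
  (\int[mu]_(x in H) (h x)%:E =
   \sum_(r <- fset_set (range h)) r%:E * mu (H `&` h @^-1` [set r]))%E.
Proof. by move=> mH; exact: (@integral_comp_nnsfun mu H h idfun). Qed.

(** The approximating functions do not depend on [mu], so the same sequence serves [nu] and all the
    [N w]. *)
Lemma cvg_integral_nnsfun_approx (mu : {measure set T -> \bar R}) (H : set T)
    (f : T -> R) (mH : measurable H) (mf : measurable_fun H (EFin \o f)) :
  (forall x, 0 <= f x) ->
  (\int[mu]_(x in H) (nnsfun_approx mH mf n x)%:E @[n --> \oo] -->
   \int[mu]_(x in H) (f x)%:E)%E.
Proof.
move=> f0; set h := nnsfun_approx mH mf.
rewrite (_ : \int[mu]_(x in H) (f x)%:E = \int[mu]_(x in H) limn (fun n => (h n x)%:E))%E.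
  apply: cvg_monotone_convergence => //.
  - by move=> n; apply/measurable_EFinP; exact: measurable_funTS.
  - by move=> n x _; rewrite lee_fin.
  - by move=> x _ m n mn; rewrite lee_fin; apply/lefP/nd_nnsfun_approx.
apply: eq_integral => x /set_mem Hx; apply/esym/cvg_lim => //.
by apply: cvg_nnsfun_approx => // y _; rewrite lee_fin.
Qed.

(** A random measure is measurable set by set; monotone simple approximation carries this over to
    integrals. Testing only subsets of [H] lets [T0] carry the sigma-algebra of the counts inside a
    region. *)
Lemma measurable_integral_measures d0 (T0 : measurableType d0)
    (k : T0 -> {measure set T -> \bar R}) (H : set T) (f : T -> R) :
  measurable H -> measurable_fun setT f -> (forall x, 0 <= f x) ->
  (forall U, measurable U -> U `<=` H -> measurable_fun setT (fun t => k t U)) ->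
  measurable_fun setT (fun t => \int[k t]_(x in H) (f x)%:E)%E.
Proof.
move=> mH mf f0 mk.
have mfH : measurable_fun H (EFin \o f) by apply/measurable_EFinP; exact: measurable_funTS.
pose h := nnsfun_approx mH mfH.
apply: (@emeasurable_fun_cvg _ _ _ _
    (fun n t => \int[k t]_(x in H) (h n x)%:E)%E) => [n|t _].
  under eq_fun do rewrite integral_nnsfun_sum//.
  apply: emeasurable_sum => r; apply: emeasurable_funM => //.
  by apply: mk; [exact: measurableI|exact: subIsetl].
exact: cvg_integral_nnsfun_approx.
Qed.

End simple_integral.

(** * Second moments of compensated integrals *)

Section compensated_integral.
Import HBNNSimple.
Context (R : realType) (d : measure_display) (Omega : measurableType d).
Variables (P : probability Omega R) (dS : measure_display) (S : measurableType dS).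
Variables (nu : {measure set S -> \bar R}) (N : Omega -> {measure set S -> \bar R}).
Hypothesis prmN : poisson_random_measure P nu N.

Local Notation compensated := (compensated nu N).

Lemma integral_compensated_sum_sqr (I : eqType) (s : seq I) (c : I -> R) (D : I -> set S) :
  uniq s -> (forall i, measurable (D i)) -> (forall i, nu (D i) < +oo)%E ->
  (forall i j, i != j -> D i `&` D j = set0) ->
  (\int[P]_w ((\sum_(i <- s) c i * compensated (D i) w) ^+ 2)%:E =
   \sum_(i <- s) (c i ^+ 2)%:E * nu (D i))%E.
Proof.
move=> us mD nuD tD.
have intM i j : P.-integrable setT
    (fun w => (c i * c j)%:E * (compensated (D i) w * compensated (D j) w)%:E)%E.
  by apply: integrableZl => //; exact: (integrable_compensatedM prmN).
rewrite (eq_integral (fun w => \sum_(i <- s) \sum_(j <- s)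
  (c i * c j)%:E * (compensated (D i) w * compensated (D j) w)%:E)%E); last first.
  move=> w _; rewrite expr2 big_distrlr/= -sumEFin; apply: eq_bigr => i _.
  by rewrite -sumEFin; apply: eq_bigr => j _; rewrite -EFinM mulrACA.
rewrite integral_sum//; last by move=> i; exact: integrable_sum.
rewrite !big_seq; apply: eq_bigr => i si; rewrite integral_sum//.
rewrite (bigD1_seq i)//= big1 ?adde0; last first.
  move=> j ji; rewrite integralZl//; last exact: (integrable_compensatedM prmN).
  by rewrite (integral_compensatedM_disjoint prmN) ?mule0// tD// eq_sym.
rewrite integralZl//; last exact: (integrable_compensatedM prmN).
rewrite -expr2; under eq_integral do rewrite -expr2.
by rewrite (integral_compensated_sqr prmN).
Qed.

Variable g : S -> R.
Hypotheses (mg : measurable_fun setT g) (g0 : forall x, 0 <= g x) (g1 : forall x, g x <= 1).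

(** This is the integral of [g] against [N - nu], taken as a difference of reals: for [nu H] finite
    and [g] bounded both integrals are almost surely finite. *)
Definition compensated_integral (H : set S) (w : Omega) : R :=
  fine (\int[N w]_(x in H) (g x)%:E) - fine (\int[nu]_(x in H) (g x)%:E).

Lemma integral_le_measure (mu : {measure set S -> \bar R}) H : measurable H ->
  (\int[mu]_(x in H) (g x)%:E <= mu H)%E.
Proof.
move=> mH; rewrite -[leRHS]mul1e -integral_cst//; apply: ge0_le_integral => //.
- by move=> x _; rewrite lee_fin.
- by apply/measurable_EFinP; exact: measurable_funTS.
- by move=> x _; rewrite lee_fin.
Qed.

Lemma integral_fin_num_le (mu : {measure set S -> \bar R}) H : measurable H ->
  mu H \is a fin_num -> (\int[mu]_(x in H) (g x)%:E)%E \is a fin_num.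
Proof.
move=> mH fH; rewrite ge0_fin_numE; last by apply: integral_ge0 => x _; rewrite lee_fin.
by apply: le_lt_trans (integral_le_measure mu mH) _; rewrite -ge0_fin_numE.
Qed.

Lemma measurable_compensated_integral H : measurable H ->
  measurable_fun setT (compensated_integral H).
Proof.
move=> mH; apply: measurable_funB => //.
apply: (measurableT_comp (@fine_measurable R _ measurableT)) => //.
apply: measurable_integral_measures => // U mU _.
exact: (measurable_count prmN).
Qed.

Lemma fine_integral_nnsfun (mu : {measure set S -> \bar R}) (H : set S)
    (h : {nnsfun S >-> R}) : measurable H -> mu H \is a fin_num ->
  fine (\int[mu]_(x in H) (h x)%:E) =
  \sum_(r <- fset_set (range h)) r * fine (mu (H `&` h @^-1` [set r])).
Proof.
move=> mH fH; apply: EFin_inj; rewrite integral_nnsfun_sum//.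
have E : (\sum_(r <- fset_set (range h)) r%:E * mu (H `&` h @^-1` [set r]) =
  (\sum_(r <- fset_set (range h)) r * fine (mu (H `&` h @^-1` [set r])))%:E)%E.
  rewrite -sumEFin; apply: eq_bigr => r _; rewrite EFinM fineK//.
  rewrite ge0_fin_numE//; apply: le_lt_trans (_ : mu H < +oo)%E; last by rewrite -ge0_fin_numE.
  exact: measureIl.
by rewrite E.
Qed.

(** For simple functions the second moment is exact, by orthogonality over disjoint level sets.
    Fatou's lemma then loses equality, but an upper bound is all that Chebyshev's inequality
    requires. *)
Lemma compensated_integral_sqr_le H : measurable H -> (nu H < +oo)%E ->
  (\int[P]_w ((compensated_integral H w) ^+ 2)%:E <= \int[nu]_(x in H) ((g x) ^+ 2)%:E)%E.
Proof.
move=> mH nuH.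
have mgH : measurable_fun H (EFin \o g) by apply/measurable_EFinP; exact: measurable_funTS.
pose h := nnsfun_approx mH mgH.
pose D n r := H `&` h n @^-1` [set r].
have mD n r : measurable (D n r) by exact: measurableI.
have nuD n r : (nu (D n r) < +oo)%E.
  by apply: le_lt_trans nuH; exact: measureIl.
pose X n w := ((\sum_(r <- fset_set (range (h n))) r * compensated (D n r) w) ^+ 2)%:E.
have mX n : measurable_fun setT (X n).
  apply/measurable_EFinP; apply: measurable_funX; apply: measurable_sum => r.
  by apply: measurable_funM => //; exact: (measurable_compensated prmN).
have X0 n w : (0 <= X n w)%E by rewrite lee_fin sqr_ge0.
have intX n : (\int[P]_w X n w <= \int[nu]_(x in H) ((g x) ^+ 2)%:E)%E.
  rewrite integral_compensated_sum_sqr//; last first.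
    by move=> r r' rr'; apply/seteqP; split=> // x [[_ /= hr] [_ /= hr']]; rewrite -hr -hr' eqxx in rr'.
  rewrite -(@integral_comp_nnsfun _ _ _ nu H (h n) (fun r => r ^+ 2))//; last first.
    by move=> r _; exact: sqr_ge0.
  apply: ge0_le_integral => //.
  - by move=> x _; rewrite lee_fin sqr_ge0.
  - by apply/measurable_EFinP; apply: measurable_funX; exact: measurable_funTS.
  - by apply/measurable_EFinP; apply: measurable_funX; exact: measurable_funTS.
  - move=> x Hx; rewrite lee_fin lerXn2r ?nnegrE//.
    rewrite /h nnsfun_approxE -lee_fin; apply: (le_approx (f := EFin \o g)) => //.
    by move=> y _; rewrite lee_fin.
(* Where [N w H] is finite the integrals of the approximants converge, so the lower limit in Fatou's
   lemma is a true limit. *)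
have cX : {ae P, forall w, limn_einf (X ^~ w) = ((compensated_integral H w) ^+ 2)%:E}.
  apply: filterS (count_ae_fin prmN mH nuH) => w fw.
  have fnu : nu H \is a fin_num by rewrite ge0_fin_numE.
  have XE n : X n w = ((fine (\int[N w]_(x in H) (h n x)%:E) -
      fine (\int[nu]_(x in H) (h n x)%:E)) ^+ 2)%:E.
    rewrite /X !fine_integral_nnsfun// -sumrB; congr ((_ ^+ 2)%:E).
    by apply: eq_bigr => r _; rewrite -mulrBr.
  apply: (cvg_limn_einf_sup _).1.
  under eq_fun do rewrite XE.
  apply: cvg_EFin; first exact: nearW.
  have c (mu : {measure set S -> \bar R}) : mu H \is a fin_num ->
      fine (\int[mu]_(x in H) (h n x)%:E) @[n --> \oo] -->
      fine (\int[mu]_(x in H) (g x)%:E).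
    move=> fmu; apply: fine_cvg; rewrite fineK; last exact: integral_fin_num_le.
    exact: cvg_integral_nnsfun_approx.
  rewrite /=; apply: (@cvg_comp _ _ _ _ (fun x : R => x ^+ 2)); last exact: exprn_continuous.
  by apply: cvgB; exact: c.
have mlim : measurable_fun setT (fun w => limn_einf (X ^~ w)).
  apply: (emeasurable_fun_cvg _ _ (measurable_fun_einfs mX)) => w _.
  by rewrite limn_einf_lim; exact: is_cvg_einfs.
rewrite (ae_eq_integral (fun w => limn_einf (X ^~ w)))//; last 2 first.
- by apply/measurable_EFinP; apply: measurable_funX; exact: measurable_compensated_integral.
- by apply: filterS cX => w ->.
apply: le_trans (fatou P measurableT mX (fun n w _ => X0 n w)) _.
rewrite limn_einf_lim; apply: lime_le; first exact: is_cvg_einfs.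
apply: nearW => n; apply: le_trans (intX n).
by apply: ereal_inf_lbound; exists n => /=.
Qed.

Lemma compensated_integral_chebyshev H (V a : R) : measurable H -> (nu H < +oo)%E ->
  (\int[nu]_(x in H) ((g x) ^+ 2)%:E <= V%:E)%E -> 0 < a ->
  (P [set w | (a <= `|compensated_integral H w|)%R] <= (V / a ^+ 2)%:E)%E.
Proof.
move=> mH nuH HV a0.
have mX : measurable_fun setT (fun w => ((compensated_integral H w) ^+ 2)%:E).
  by apply/measurable_EFinP; apply: measurable_funX; exact: measurable_compensated_integral.
have := le_integral_abse P measurableT mX (exprn_gt0 2 a0).
rewrite setTI.
have -> : [set w | ((a ^+ 2)%:E <= `|(compensated_integral H w ^+ 2)%:E|)%E] =
          [set w | (a <= `|compensated_integral H w|)%R].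
  apply/seteqP; split=> w /=; rewrite lee_fin normrX.
    by rewrite ler_pXn2r ?nnegrE// ltW.
  by rewrite ler_pXn2r ?nnegrE// ltW.
under eq_integral do rewrite gee0_abs ?lee_fin ?sqr_ge0//.
move=> h; rewrite EFinM lee_pdivlMr ?exprn_gt0// muleC.
by apply: le_trans h _; apply: le_trans (compensated_integral_sqr_le _ _) HV.
Qed.

End compensated_integral.

(** * Independence over disjoint regions *)

Lemma measurable_forall d (T : measurableType d) (I : finType) (F : I -> set T) :
  (forall i, measurable (F i)) -> measurable [set w | forall i, F i w].
Proof.
move=> mF; rewrite (_ : [set w | _] = \bigcap_(i in [set: I]) F i); last first.
  by apply/seteqP; split=> w h i //; apply: h.
by apply: fin_bigcap_measurable.
Qed.

Section independence.
Context (R : realType) (d : measure_display) (Omega : measurableType d).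
Variable P : probability Omega R.

(** Dynkin's argument: the events satisfying the product rule with the fixed [B] are stable under
    complements and disjoint countable unions. *)
Lemma independent_g_sigma_algebra_l (G : set (set Omega)) (B : set Omega) :
  G `<=` measurable -> setI_closed G -> measurable B ->
  (forall A, G A -> P (A `&` B) = (P A * P B)%E) ->
  forall A, <<s G >> A -> P (A `&` B) = (P A * P B)%E.
Proof.
move=> Gm GI mB GB.
have sGm A : <<s G >> A -> measurable A.
  by move=> sA; apply: sA; split => //; exact: sigma_algebra_measurable.
pose Q := [set A : set Omega | P (A `&` B) = (P A * P B)%E].
apply: (@dynkin_induction _ (g_sigma_algebraType G) G Q) => //.
- by rewrite /Q /= setTI probability_setT mul1e.
- move=> A /sGm mA; rewrite /Q/= => PAB.
  have -> : P (~` A `&` B) = (P B - P (A `&` B))%E.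
    rewrite setIC -setDE [A `&` B]setIC; apply: measureD => //.
    by rewrite -ge0_fin_numE// fin_num_measure.
  rewrite PAB probability_setC//.
  by rewrite muleBl ?mul1e// ?fin_num_measure// fin_num_adde_defl// fin_numN fin_num_measure.
- move=> F mF tF QF; rewrite /Q /= setI_bigcupl.
  have mF' n : d.-measurable (F n : set Omega) by exact: (sGm _ (mF n)).
  rewrite (@measure_bigcup _ _ _ P setT (fun k => F k `&` B)); last 2 first.
  - by move=> i _; exact: measurableI.
  - exact: trivIset_setIr.
  rewrite (@measure_bigcup _ _ _ P setT F)//.
  rewrite muleC -(fineK (fin_num_measure P _ mB)) -nneseriesZl//.
  apply: eq_eseriesr => n _; apply: etrans (QF n) _.
  by rewrite muleC fineK// fin_num_measure.
Qed.

(** One side is enlarged while the other stays among its generators; then the roles are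
    exchanged. *)
Lemma independent_g_sigma_algebra (G1 G2 : set (set Omega)) :
  G1 `<=` measurable -> G2 `<=` measurable -> setI_closed G1 -> setI_closed G2 ->
  (forall A B, G1 A -> G2 B -> P (A `&` B) = (P A * P B)%E) ->
  forall A B, <<s G1 >> A -> <<s G2 >> B -> P (A `&` B) = (P A * P B)%E.
Proof.
move=> G1m G2m G1I G2I GG A B sA sB.
have sG1m : <<s G1 >> `<=` measurable.
  by move=> C sC; apply: sC; split => //; exact: sigma_algebra_measurable.
rewrite setIC muleC; apply: (independent_g_sigma_algebra_l G2m G2I) => //.
  exact: sG1m.
move=> C GC; rewrite setIC muleC.
by apply: (independent_g_sigma_algebra_l G1m G1I) => //; [exact: G2m|move=> E GE; exact: GG].
Qed.

Context (dS : measure_display) (S : measurableType dS).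
Variables (nu : {measure set S -> \bar R}) (N : Omega -> {measure set S -> \bar R}).
Hypothesis prmN : poisson_random_measure P nu N.

(** A pi-system generating the sigma-algebra of the counts of the selected cells. Selecting by [J]
    keeps both sides of an independence statement inside one disjoint family, the form in which the
    independence clause is given. *)
Definition rectangles n (D : 'I_n -> set S) (J : pred 'I_n) : set (set Omega) :=
  [set A | exists U : 'I_n -> set (\bar R), (forall i, measurable (U i)) /\
     A = [set w | forall i, J i -> U i (N w (D i))]].

Lemma measurable_count_preimage E U : measurable E -> measurable U ->
  measurable [set w | U (N w E)].
Proof.
by move=> mE mU; have := measurable_count prmN mE measurableT mU; rewrite setTI.
Qed.

Lemma rectangles_measurable n (D : 'I_n -> set S) J :
  (forall i, measurable (D i)) -> rectangles D J `<=` measurable.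
Proof.
move=> mD _ [U [mU ->]].
rewrite (_ : [set w | _] = [set w | forall i, (if J i then [set w | U i (N w (D i))] else setT) w]).
  apply: (@measurable_forall _ _ _ (fun i => if J i then [set w | U i (N w (D i))] else setT)) => i.
  by case: (J i) => //; exact: measurable_count_preimage.
apply/seteqP; split=> w /= h i; first by case: ifP => // /h.
by move=> Ji; have := h i; rewrite Ji.
Qed.

Lemma rectangles_setI n (D : 'I_n -> set S) J : setI_closed (rectangles D J).
Proof.
move=> _ _ [U [mU ->]] [V [mV ->]]; exists (fun i => U i `&` V i); split.
  by move=> i; exact: measurableI.
apply/seteqP; split=> w /=.
  by move=> [hU hV] i Ji; split; [exact: hU|exact: hV].
by move=> h; split=> i /h[].
Qed.

(** Constraints are padded with [setT] outside the selected cells, so each cell contributes a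
    trivial factor to one of the two events. *)
Lemma rectangles_independent n (D : 'I_n -> set S) (J : pred 'I_n) A B :
  (forall i, measurable (D i)) -> (forall i j, i != j -> D i `&` D j = set0) ->
  rectangles D J A -> rectangles D (predC J) B ->
  P (A `&` B) = (P A * P B)%E.
Proof.
move=> mD tD [U [mU ->]] [V [mV ->]].
pose U' i := if J i then U i else setT.
pose V' i := if J i then setT else V i.
have mU' i : measurable (U' i) by rewrite /U'; case: ifP.
have mV' i : measurable (V' i) by rewrite /V'; case: ifP.
have -> : [set w | forall i, J i -> U i (N w (D i))] = [set w | forall i, U' i (N w (D i))].
  apply/seteqP; split=> w h i; first by rewrite /U'; case: ifP => // /h.
  by move: (h i); rewrite /U' => + Ji; rewrite Ji.
have -> : [set w | forall i, predC J i -> V i (N w (D i))] =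
    [set w | forall i, V' i (N w (D i))].
  apply/seteqP; split=> w h i; first by rewrite /V'; case: ifP => // /negbT/h.
  by move: (h i); rewrite /V' => + /= /negbTE Ji; rewrite Ji.
have -> : [set w | forall i, U' i (N w (D i))] `&` [set w | forall i, V' i (N w (D i))] =
    [set w | forall i, (U' i `&` V' i) (N w (D i))].
  by apply/seteqP; split=> w /=; [case=> h1 h2 i; split|move=> h; split=> i; case: (h i)].
have [_ [_ [_ ind]]] := prmN.
apply: etrans (ind _ D (fun i => U' i `&` V' i) mD _ tD) _.
  by move=> i; exact: measurableI.
rewrite (ind _ D U')// (ind _ D V')//.
rewrite -big_split/=; apply: eq_bigr => i _; rewrite /U' /V'.
have setT1 : [set w | [set: \bar R] (N w (D i))] = setT by apply/seteqP.
case: (J i); rewrite setT1 probability_setT ?mule1 ?mul1e; congr (P _).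
  by apply/seteqP; split=> w //= -[].
by apply/seteqP; split=> w //= -[].
Qed.

(** The sets [E i] may overlap. Any finite index type is allowed, so that two events intersect over
    the sum of their index types. *)
Definition count_events (D : set S) : set (set Omega) :=
  [set A | exists (I : finType) (E : I -> set S) (U : I -> set (\bar R)),
     (forall i, [/\ measurable (E i), E i `<=` D & measurable (U i)]) /\
     A = [set w | forall i, U i (N w (E i))]].

Lemma count_events_measurable D : count_events D `<=` measurable.
Proof.
move=> _ [I [E [U [h ->]]]]; apply: measurable_forall => i.
by have [mE _ mU] := h i; exact: measurable_count_preimage.
Qed.

Lemma count_events_setI D : setI_closed (count_events D).
Proof.
move=> _ _ [I [E [U [h ->]]]] [I' [E' [U' [h' ->]]]].
exists (I + I')%type, (fun i => match i with inl i => E i | inr i => E' i end),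
  (fun i => match i with inl i => U i | inr i => U' i end); split; first by case.
apply/seteqP; split=> w /=; first by case=> h1 h2 [].
by move=> hw; split=> i; [exact: (hw (inl i))|exact: (hw (inr i))].
Qed.

Lemma count_atoms_measurable n (D : 'I_n -> set S) (J : pred 'I_n) (E : set S)
    (Q : pred 'I_n) (U : set (\bar R)) :
  (forall i, measurable (D i)) -> (forall i j, i != j -> D i `&` D j = set0) ->
  (forall i, Q i -> J i) -> E = \big[setU/set0]_(i < n | Q i) D i ->
  measurable U -> <<s rectangles D J >> [set w | U (N w E)].
Proof.
move=> mD tD QJ -> mU.
have mN i : J i -> measurable_fun setT (fun w : g_sigma_algebraType (rectangles D J) => N w (D i)).
  move=> Ji _ /= V mV; rewrite setTI; apply: sub_sigma_algebra.
  exists (fun j => if j == i then V else setT); split; first by move=> j; case: ifP.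
  apply/seteqP; split=> w /=.
    by move=> h j _; case: ifP => // /eqP ->.
  by move=> /(_ i Ji); rewrite eqxx.
have tQ : trivIset Q D.
  by move=> i j _ _ [x [Dix Djx]]; apply: contrapT => /eqP/tD; apply/eqP/set0P; exists x.
have mS : measurable_fun setT (fun w : g_sigma_algebraType (rectangles D J) =>
    (\sum_(i < n) (if Q i then N w (D i) else 0))%E).
  apply: emeasurable_sum => i; case: (boolP (Q i)) => [/QJ/mN//|_].
  exact: measurable_cst.
have := mS measurableT _ mU; rewrite setTI.
rewrite (_ : _ @^-1` U = [set w | U (N w (\big[setU/set0]_(i < n | Q i) D i))])//.
have NE w : N w (\big[setU/set0]_(i < n | Q i) D i) =
    (\sum_(i < n) (if Q i then N w (D i) else 0))%E.
  by rewrite measure_bigsetU_ord_cond// big_mkcond.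
by apply/seteqP; split=> w /=; rewrite NE.
Qed.

(** The independence clause speaks of disjoint sets only, so the overlapping sets on both sides are
    refined to common atoms, each count becoming a sum over atoms. The atoms are then separated
    according to whether they lie in [D]. *)
Lemma count_events_independent D D' A B : measurable D -> D `&` D' = set0 ->
  count_events D A -> count_events D' B -> P (A `&` B) = (P A * P B)%E.
Proof.
move=> mD DD' [I [E [U [hE ->]]]] [I' [E' [U' [hE' ->]]]].
(* [None] adds [D] itself to the generating sets, so that every atom lies inside [D] or outside
   it. *)
pose F (k : option (I + I')) := match k with
  | None => D | Some (inl i) => E i | Some (inr i) => E' i end.
have mF k : measurable (F k).
  by case: k => [[i|i]|]//=; [have [] := hE i|have [] := hE' i].
pose K := {set option (I + I')}.
(* The atoms of the algebra generated by the [F k], indexed by signatures. *)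
pose sgn (x : S) : K := [set k | `[< F k x >]]%SET.
pose At (i : 'I_#|{: K}|) := [set x | sgn x = enum_val i].
have sgnE x k : (k \in sgn x) = `[< F k x >] by rewrite inE.
have mAt i : measurable (At i).
  rewrite (_ : At i = \bigcap_(k in [set: option (I + I')])
      (if k \in enum_val i then F k else ~` F k)).
    by apply: fin_bigcap_measurable => // k _; case: ifP => // _; exact: measurableC.
  apply/seteqP; split=> x /=.
    by move=> <- k _; rewrite sgnE; case: asboolP.
  move=> h; apply/setP => k; rewrite sgnE; have := h k Logic.I.
  by case: ifP => _ => [?|?]; [apply/asboolP|apply/asboolP].
have tAt i j : i != j -> At i `&` At j = set0.
  move=> ij; apply/seteqP; split=> // x [/= si sj].
  by move: ij; rewrite -(inj_eq enum_val_inj) -si -sj eqxx.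
pose J (i : 'I_#|{: K}|) := None \in enum_val i.
have FE k (G : pred 'I_#|{: K}|) : (forall x i, At i x -> F k x -> G i) ->
    F k = \big[setU/set0]_(i < #|{: K}| | G i && (k \in enum_val i)) At i.
  move=> hG; rewrite -bigcup_seq_cond; apply/seteqP; split=> x /=.
    move=> Fx; exists (enum_rank (sgn x)) => /=; last by rewrite /At/= enum_rankK.
    rewrite mem_index_enum (hG x)//=; last by rewrite /At /= enum_rankK.
    by rewrite enum_rankK sgnE; apply/asboolP.
  by move=> [i /= /and3P[_ _ ki]]; rewrite /At /= => sx; apply/asboolP; rewrite -sgnE sx.
apply: (@independent_g_sigma_algebra (rectangles At J) (rectangles At (predC J))).
- exact: rectangles_measurable.
- exact: rectangles_measurable.
- exact: rectangles_setI.
- exact: rectangles_setI.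
- by move=> A0 B0; exact: rectangles_independent.
- apply: (@measurable_forall _ (g_sigma_algebraType (rectangles At J)) I
    (fun i => [set w | U i (N w (E i))])) => i.
  have [mE ED mU] := hE i.
  apply: (@count_atoms_measurable _ At J _
    (fun j => J j && (Some (inl i) \in enum_val j))) => //; first by move=> j /andP[].
  apply: (FE (Some (inl i)) J) => x j sx /ED Dx.
  have {}sx : sgn x = enum_val j := sx.
  by rewrite /J -sx sgnE; exact/asboolP.
- apply: (@measurable_forall _ (g_sigma_algebraType (rectangles At (predC J))) I'
    (fun i => [set w | U' i (N w (E' i))])) => i.
  have [mE ED mU] := hE' i.
  apply: (@count_atoms_measurable _ At (predC J) _
    (fun j => predC J j && (Some (inr i) \in enum_val j))) => //; first by move=> j /andP[].
  apply: (FE (Some (inr i)) (predC J)) => x j sx /ED Dx.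
  have {}sx : sgn x = enum_val j := sx.
  rewrite /J/= -sx sgnE.
  by apply/asboolPn => D'x; have : (D `&` D') x by []; rewrite DD'.
Qed.

Lemma count_sigma_independent D D' A B : measurable D -> D `&` D' = set0 ->
  <<s count_events D >> A -> <<s count_events D' >> B -> P (A `&` B) = (P A * P B)%E.
Proof.
move=> mD DD'; apply: independent_g_sigma_algebra.
- exact: count_events_measurable.
- exact: count_events_measurable.
- exact: count_events_setI.
- exact: count_events_setI.
- by move=> A0 B0; exact: count_events_independent.
Qed.

Lemma measurable_count_events D E : measurable E -> E `<=` D ->
  measurable_fun setT (fun w : g_sigma_algebraType (count_events D) => N w E).
Proof.
move=> mE ED _ /= V mV; rewrite setTI; apply: sub_sigma_algebra.
exists unit, (fun=> E), (fun=> V); split => //.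
by apply/seteqP; split=> w //= /(_ tt).
Qed.

Lemma measurable_compensated_integral_events (g : S -> R) D H :
  measurable_fun setT g -> (forall x, 0 <= g x) -> measurable H -> H `<=` D ->
  measurable_fun setT
    (compensated_integral nu N g H : g_sigma_algebraType (count_events D) -> R).
Proof.
move=> mg g0 mH HD; apply: measurable_funB => //.
apply: (measurableT_comp (@fine_measurable R _ measurableT)) => //.
apply: (@measurable_integral_measures _ _ _ _ (g_sigma_algebraType (count_events D)) N) => //.
by move=> U mU UH; apply: measurable_count_events => //; exact: subset_trans HD.
Qed.

End independence.

(** * Etemadi's maximal inequality for compensated integrals *)

Section etemadi.
Context (R : realType) (d : measure_display) (Omega : measurableType d).
Variable P : probability Omega R.

(** [M k] stands for a large value at step [k], [A] for a large final value, [M' k] for a large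
    remaining increment, [Z] for null exceptions. [seqDU M k] says that [k] is the first large step;
    these events are disjoint, so by independence their intersections with [M' k] have total
    probability at most [q]. *)
Lemma etemadi_events n (M M' : nat -> set Omega) (A Z : set Omega) (p q : R) :
  (forall k, measurable (M k)) -> (forall k, measurable (M' k)) ->
  measurable A -> measurable Z -> P Z = 0%E ->
  (P A <= p%:E)%E -> (forall k, (k < n)%N -> (P (M' k) <= q%:E)%E) -> 0 <= q ->
  (forall k, (k < n)%N -> P (seqDU M k `&` M' k) = (P (seqDU M k) * P (M' k))%E) ->
  (forall k, (k < n)%N -> M k `<=` A `|` M' k `|` Z) ->
  (P (\big[setU/set0]_(k < n) M k) <= (p + q)%:E)%E.
Proof.
move=> mM mM' mA mZ PZ pA qM' q0 ind sub.
have mB k : measurable (seqDU M k) by exact: seqDU_measurable.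
have mBM k : measurable (seqDU M k `&` M' k) by exact: measurableI.
have mU (F : nat -> set Omega) : (forall k, measurable (F k)) ->
  measurable (\big[setU/set0]_(k < n) F k) by move=> mF; exact: bigsetU_measurable.
have sumB : (\sum_(k < n) P (seqDU M k) <= 1)%E.
  rewrite -(@measure_semi_additive_ord_I _ _ _ P (seqDU M) n)//.
  - exact: probability_le1 (mU _ mB).
  - by apply: sub_trivIset (trivIset_seqDU M).
  - exact: (mU (seqDU M)).
apply: (@le_trans _ _ (P (A `|` Z `|` \big[setU/set0]_(k < n) (seqDU M k `&` M' k)))).
  apply: le_measure.
  - exact/mem_set/(mU M).
  - by apply/mem_set; apply: measurableU; [exact: measurableU|exact: (mU (fun k => seqDU M k `&` M' k))].
  - rewrite bigsetU_seqDU -!bigcup_mkord => w [k /= kn Bk].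
    have := sub k kn w (subset_seqDU Bk).
    case=> [[?|?]|?]; [by left; left|right|by left; right].
    by rewrite -(bigcup_mkord n (fun k => seqDU M k `&` M' k)); exists k.
have PU (E F : set Omega) : measurable E -> measurable F -> (P (E `|` F) <= P E + P F)%E.
  by move=> mE mF; exact: measureU2.
have mAZ : measurable (A `|` Z) by exact: measurableU.
apply: (le_trans (PU _ _ mAZ (mU (fun k => seqDU M k `&` M' k) mBM))).
rewrite EFinD; apply: leeD.
  by apply: (le_trans (PU _ _ mA mZ)); rewrite PZ adde0.
apply: (le_trans (@content_subadditive _ _ _ P _ (fun k => seqDU M k `&` M' k) n _
  (mU (fun k => seqDU M k `&` M' k) mBM) _)) => //.
apply: (@le_trans _ _ (\sum_(k < n) P (seqDU M k) * q%:E)%E).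
  have le_ind k : (k < n)%N -> (P (seqDU M k `&` M' k) <= P (seqDU M k) * q%:E)%E.
    by move=> kn; rewrite ind//; apply: lee_wpmul2l => //; exact: qM'.
  by apply: lee_sum => k _; exact: le_ind.
rewrite -ge0_sume_distrl; last by move=> k _; exact: measure_ge0.
by rewrite -[leRHS]mul1e; apply: lee_wpmul2r.
Qed.

Context (dS : measure_display) (S : measurableType dS).
Variables (nu : {measure set S -> \bar R}) (N : Omega -> {measure set S -> \bar R}).
Hypothesis prmN : poisson_random_measure P nu N.
Variable g : S -> R.
Hypotheses (mg : measurable_fun setT g) (g0 : forall x, 0 <= g x) (g1 : forall x, g x <= 1).

Local Notation C := (compensated_integral nu N g).

(** Finiteness of [N w H2] is needed because [fine] is additive on finite values only; this is the
    source of the null set in the Etemadi argument. *)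
Lemma compensated_integralD (H1 H2 : set S) w : measurable H1 -> measurable H2 ->
  H1 `<=` H2 -> N w H2 \is a fin_num -> nu H2 \is a fin_num ->
  C H2 w = C H1 w + C (H2 `\` H1) w.
Proof.
move=> mH1 mH2 H12 Nfin nufin.
have mD : measurable (H2 `\` H1) by exact: measurableD.
have add (mu : {measure set S -> \bar R}) : mu H2 \is a fin_num ->
    fine (\int[mu]_(x in H2) (g x)%:E) =
    fine (\int[mu]_(x in H1) (g x)%:E) + fine (\int[mu]_(x in H2 `\` H1) (g x)%:E).
  move=> fmu.
  have fH H : measurable H -> H `<=` H2 -> (\int[mu]_(x in H) (g x)%:E)%E \is a fin_num.
    move=> mH HH; apply: integral_fin_num_le => //.
    rewrite ge0_fin_numE//; apply: (le_lt_trans (y := mu H2)).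
      by apply: le_measure; [exact/mem_set|exact/mem_set|].
    by rewrite -ge0_fin_numE.
  rewrite -fineD ?fH//; congr fine.
  rewrite -{1}(setDUK H12) ge0_integral_setU//.
  - by apply/measurable_EFinP; exact: measurable_funTS.
  - by move=> x _; rewrite lee_fin.
  - by rewrite disj_set2E setDIK.
by rewrite /compensated_integral !add//; ring.
Qed.

(** Rows make the maximum norm of a vector available to Etemadi's argument: rows of length one for
    chains in time, rows over a time grid for chains in the truncation level. *)
Definition exceed (a : R) (H : nat -> set S) (r : nat) : set Omega :=
  [set w | exists2 i, (i < r)%N & a <= `|C (H i) w|].

Lemma exceed_events a H r (D : set S) :
  (forall i, measurable (H i)) -> (forall i, H i `<=` D) ->
  <<s count_events N D >> (exceed a H r).
Proof.
move=> mH HD.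
rewrite (_ : exceed a H r = \bigcup_(i in [set i | (i < r)%N])
   [set w : g_sigma_algebraType (count_events N D) | a <= `|C (H i) w|]).
  apply: (@bigcup_measurable _ (g_sigma_algebraType (count_events N D))) => i _.
  have mC : measurable_fun setT (fun w : g_sigma_algebraType (count_events N D) => `|C (H i) w|).
    apply: measurableT_comp => //.
    exact: measurable_compensated_integral_events.
  rewrite -[X in measurable X]setTI.
  by apply: measurable_fun_le => //; exact: measurable_cst.
by apply/seteqP; split=> w [i ir h]; exists i.
Qed.

Lemma count_sigma_measurable D A : <<s count_events N D >> A -> measurable A.
Proof.
move=> sA; apply: sA; split; first exact: sigma_algebra_measurable.
exact: (count_events_measurable prmN).
Qed.

(** The rows up to [k] depend on counts inside [G k], the remaining increment on counts outside it;
    this gives the independence that [etemadi_events] asks for. *)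
Lemma etemadi_compensated n r (H : nat -> nat -> set S) (G : nat -> set S) (a p q : R) :
  (forall k i, measurable (H k i)) -> (forall k, measurable (G k)) ->
  (forall k i, nu (H k i) < +oo)%E ->
  (forall j k, (j <= k)%N -> G j `<=` G k) ->
  (forall k i, (k <= n)%N -> H k i `<=` H n i) ->
  (forall k i, H k i `<=` G k) ->
  (forall k i, (k <= n)%N -> (H n i `\` H k i) `&` G k = set0) ->
  0 <= q ->
  (P (exceed a (H n) r) <= p%:E)%E ->
  (forall k, (k <= n)%N -> (P (exceed (2 * a) (fun i => H n i `\` H k i) r) <= q%:E)%E) ->
  (P (\big[setU/set0]_(k < n.+1) exceed (3 * a) (H k) r) <= (p + q)%:E)%E.
Proof.
move=> mH mG nuH GG HH HG HDG q0 pn qk.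
have mD k i : measurable (H n i `\` H k i) by exact: measurableD.
have mE b k : measurable (exceed b (H k) r).
  by apply: count_sigma_measurable (exceed_events _ _ _ _) => //; exact: HG.
have mE' b k : measurable (exceed b (fun i => H n i `\` H k i) r).
  by apply: count_sigma_measurable (exceed_events _ _ (mD k) (fun i => @subsetT _ _)).
have [Z [mZ PZ NZ]] : {ae P, forall w, forall i, N w (H n i) \is a fin_num}.
  by apply: ae_foralln => i; exact: (count_ae_fin prmN).
apply: (@etemadi_events n.+1 (fun k => exceed (3 * a) (H k) r)
  (fun k => exceed (2 * a) (fun i => H n i `\` H k i) r) (exceed a (H n) r) Z) => //.
- move=> k kn; apply: (count_sigma_independent prmN (D := G k) (D' := ~` G k)) => //.
  + by rewrite setICr.
  + have sE j : (j <= k)%N -> <<s count_events N (G k) >> (exceed (3 * a) (H j) r).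
      by move=> jk; apply: exceed_events => // i; apply: subset_trans (GG _ _ jk); exact: HG.
    apply: (@measurableD _ (g_sigma_algebraType (count_events N (G k)))); first exact: sE.
    apply: (@bigsetU_measurable _ (g_sigma_algebraType (count_events N (G k)))) => j _.
    by apply: sE; exact: ltnW.
  + apply: exceed_events => // i; apply/disjoints_subset; exact: HDG.
- move=> k kn w [i ir h].
  have [Zw|Zw] := pselect (Z w); [by right|left].
  have Nfin : N w (H n i) \is a fin_num by move: i {ir h}; apply: contrapT => /NZ.
  (* [C (H k i) w] is the final value minus the remaining increment, so size [3 * a] forces the
     former to reach [a] or the latter [2 * a]. *)
  have [h1|h1] := leP a `|C (H n i) w|; [by left; exists i|right; exists i => //].
  have := compensated_integralD (mH k i) (mH n i) (HH _ _ kn) Nfin.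
  rewrite ge0_fin_numE// => /(_ (nuH _ _)) e.
  have := ler_normB (C (H n i) w) (C (H n i `\` H k i) w).
  by rewrite e addrK -e; lra.
Qed.

End etemadi.

(** * Uniform Cauchy property over dyadic times *)

Section uniform_cauchy.
Context (R : realType) (d : measure_display) (Omega : measurableType d).
Variable P : probability Omega R.
Context (dS : measure_display) (S : measurableType dS).
Variables (nu : {measure set S -> \bar R}) (N : Omega -> {measure set S -> \bar R}).
Hypothesis prmN : poisson_random_measure P nu N.
Variable g : S -> R.
Hypotheses (mg : measurable_fun setT g) (g0 : forall x, 0 <= g x) (g1 : forall x, g x <= 1).

Local Notation C := (compensated_integral nu N g).
Local Notation exceed := (exceed nu N g).

Lemma measurable_exceed a (H : nat -> set S) r : (forall i, measurable (H i)) ->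
  measurable (exceed a H r).
Proof.
move=> mH; apply: (count_sigma_measurable prmN (D := setT)).
by apply: exceed_events.
Qed.

Lemma subset_integral_sqr (A B : set S) (V : R) : measurable A -> measurable B ->
  A `<=` B -> (\int[nu]_(x in B) ((g x) ^+ 2)%:E <= V%:E)%E ->
  (\int[nu]_(x in A) ((g x) ^+ 2)%:E <= V%:E)%E.
Proof.
move=> mA mB AB; apply: le_trans; apply: ge0_subset_integral => //.
- by apply/measurable_EFinP; apply: measurable_funX; exact: measurable_funTS.
- by move=> x _; rewrite lee_fin sqr_ge0.
Qed.

Lemma exceed1_chebyshev (A : set S) (V a : R) : measurable A -> (nu A < +oo)%E ->
  (\int[nu]_(x in A) ((g x) ^+ 2)%:E <= V%:E)%E -> 0 < a ->
  (P (exceed a (fun=> A) 1) <= (V / a ^+ 2)%:E)%E.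
Proof.
move=> mA nuA VA a0.
rewrite (_ : exceed a _ 1 = [set w | a <= `|C A w|]).
  exact: (compensated_integral_chebyshev prmN mg g0 g1).
by apply/seteqP; split=> w /=; [move=> [i _ h]|move=> h; exists 0%N].
Qed.

(** Chebyshev costs [V / a^2] for the final value and [V / (2 a)^2] for an increment; the sum is
    rounded up to [2 V / a^2]. *)
Lemma exceed_chain (A : nat -> set S) r (V a : R) :
  (forall i, measurable (A i)) -> (forall i, nu (A i) < +oo)%E ->
  (forall i j, (i <= j)%N -> A i `<=` A j) ->
  (\int[nu]_(x in A r) ((g x) ^+ 2)%:E <= V%:E)%E -> 0 < a -> 0 <= V ->
  (P (exceed (3 * a) A r.+1) <= (2 * V / a ^+ 2)%:E)%E.
Proof.
move=> mA nuA AA VA a0 V0.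
rewrite (_ : exceed (3 * a) A r.+1 =
    \big[setU/set0]_(k < r.+1) exceed (3 * a) (fun=> A k) 1); last first.
  rewrite -(bigcup_mkord r.+1 (fun k => exceed (3 * a) (fun=> A k) 1)).
  apply/seteqP; split=> w /=.
    by move=> [i ir h]; exists i => //; exists 0%N.
  by move=> [i /= ir [_ _ h]]; exists i.
apply: (@le_trans _ _ (V / a ^+ 2 + V / (2 * a) ^+ 2)%:E).
  apply: (@etemadi_compensated _ _ _ _ _ _ _ _ prmN _ mg g0 g1 r 1
    (fun k _ => A k) A) => //.
  - by move=> k i; exact: AA.
  - by move=> k _; exact: subset_refl.
  - by move=> k i _; apply/seteqP; split=> // x [[_ nAk] /nAk].
  - by rewrite divr_ge0// sqr_ge0.
  - exact: exceed1_chebyshev.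
  - move=> k kr; apply: exceed1_chebyshev => //.
    + exact: measurableD.
    + apply: le_lt_trans (nuA r); apply: le_measure.
      * by apply/mem_set; exact: measurableD.
      * exact/mem_set.
      * exact: subDsetl.
    + apply: subset_integral_sqr VA => //; exact: measurableD.
    + by rewrite mulr_gt0.
rewrite lee_fin exprMn.
have : 0 <= V / a ^+ 2 by rewrite divr_ge0// sqr_ge0.
have an0 : a != 0 by rewrite gt_eqF.
have -> : V / (2 ^+ 2 * a ^+ 2) = V / a ^+ 2 / 4 by field.
rewrite -[2 * V / _]mulrA; lra.
Qed.

Variables (E : R -> set S) (K : nat -> set S) (T : nat) (v : nat -> R).
Hypotheses (mE : forall t, measurable (E t)) (mK : forall m, measurable (K m)).
Hypothesis E_le : forall s t : R, 0 <= s -> s <= t -> E s `<=` E t.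
Hypothesis K_le : forall m n, (m <= n)%N -> K m `<=` K n.
Hypothesis nuEK : forall t m, (nu (E t `&` K m) < +oo)%E.
Hypothesis v_bound : forall n m, (n <= m)%N ->
  (\int[nu]_(x in E T%:R `&` (K m `\` K n)) ((g x) ^+ 2)%:E <= (v n)%:E)%E.
Hypothesis v0 : forall n, 0 <= v n.
Hypothesis v_cvg : v @ \oo --> (0 : R).

Definition dyadic (k i : nat) : R := i%:R / 2 ^+ k.

Lemma dyadic_le k i j : (i <= j)%N -> dyadic k i <= dyadic k j.
Proof. by move=> ij; rewrite /dyadic ler_pM2r ?invr_gt0 ?exprn_gt0// ler_nat. Qed.

Lemma dyadic_ge0 k i : 0 <= dyadic k i.
Proof. by rewrite /dyadic divr_ge0// exprn_ge0. Qed.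

Lemma dyadicS k i : dyadic k.+1 (2 * i) = dyadic k i.
Proof.
have h : (2 : R) ^+ k != 0 by rewrite expf_neq0.
by rewrite /dyadic exprS natrM; field.
Qed.

Lemma dyadic_top k : dyadic k (T * 2 ^ k) = T%:R.
Proof. by rewrite /dyadic natrM natrX mulfK// expf_neq0. Qed.

Local Notation block k n m i := (E (dyadic k i) `&` (K m `\` K n)).

Let mblock k n m i : measurable (block k n m i).
Proof. by apply: measurableI => //; exact: measurableD. Qed.

Let nublock k n m i : (nu (block k n m i) < +oo)%E.
Proof.
apply: le_lt_trans (nuEK (dyadic k i) m); apply: le_measure.
- exact/mem_set/mblock.
- by apply/mem_set; exact: measurableI.
- by apply: setIS; exact: subDsetl.
Qed.

Let block_le k n m i j : (i <= j)%N -> block k n m i `<=` block k n m j.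
Proof. by move=> ij; apply: setSI; apply: E_le; [exact: dyadic_ge0|exact: dyadic_le]. Qed.

(** Etemadi along the truncation step [j], each row running over all grid times. [exceed_chain]
    bounds the last row at level [3 * b] and the increments at level [2 * (3 * b) = 3 * (2 * b)];
    the total [2 v / b^2 + v / (2 b^2)], with [v = v n], is rounded up to [3 v / b^2], free of [J]
    and [k]. *)
Lemma exceed_grid n J k (b : R) : 0 < b ->
  (P (\big[setU/set0]_(j < J.+1)
        exceed (3 * (3 * b)) (fun i => block k n (n + j) i) (T * 2 ^ k).+1)
   <= (3 * v n / b ^+ 2)%:E)%E.
Proof.
move=> b0.
apply: (@le_trans _ _ (2 * v n / b ^+ 2 + 2 * v n / (2 * b) ^+ 2)%:E).
  apply: (@etemadi_compensated _ _ _ _ _ _ _ _ prmN _ mg g0 g1 J (T * 2 ^ k).+1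
    (fun j i => block k n (n + j) i) (fun j => K (n + j))) => //.
  - by move=> i j ij; apply: K_le; rewrite leq_add2l.
  - move=> j i jJ; apply: setIS; apply: setSD; apply: K_le; by rewrite leq_add2l.
  - by move=> j i x [_ []].
  - move=> j i jJ; apply/seteqP; split=> // x [[[Ex [_ nK]] h] Kx].
    by apply: h.
  - by rewrite divr_ge0// ?sqr_ge0// mulr_ge0.
  - apply: exceed_chain => //.
      by move=> i j ij; exact: block_le.
    by rewrite dyadic_top; apply: v_bound; exact: leq_addr.
  - move=> j jJ; rewrite mulrCA; apply: exceed_chain => //.
    + by move=> i; exact: measurableD.
    + move=> i; apply: le_lt_trans (nublock k n (n + J) i); apply: le_measure.
      * by apply/mem_set; exact: measurableD.
      * exact/mem_set/mblock.
      * exact: subDsetl.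
    (* A difference of two rows still grows in time: only marks between two fixed truncation levels
       remain in it. *)
    + move=> i i' ii' x [Bx nBx]; split; first exact: (block_le ii' Bx).
      by move=> [_ h]; apply: nBx; split=> //; case: Bx.
    + have := v_bound (leq_addr J n); apply: subset_integral_sqr.
      * exact: measurableD.
      * by apply: measurableI => //; exact: measurableD.
      * by rewrite dyadic_top; exact: subDsetl.
    + by rewrite mulr_gt0.
rewrite lee_fin exprMn.
have : 0 <= v n / b ^+ 2 by rewrite divr_ge0// sqr_ge0.
have bn0 : b != 0 by rewrite gt_eqF.
have -> : 2 * v n / (2 ^+ 2 * b ^+ 2) = v n / b ^+ 2 / 2 by field.
rewrite -![_ * v n / _]mulrA; lra.
Qed.

(** The single index [L] controls both the mesh and the number of truncation steps, so these
    finite-grid events form one increasing sequence. *)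
Let bad n b L := \big[setU/set0]_(j < L.+1)
  exceed (3 * (3 * b)) (fun i => block L n (n + j) i) (T * 2 ^ L).+1.

Let badE n b L w : bad n b L w <->
  exists j i, [/\ (j <= L)%N, (i <= T * 2 ^ L)%N & 3 * (3 * b) <= `|C (block L n (n + j) i) w|].
Proof.
rewrite /bad -(bigcup_mkord L.+1 (fun j =>
  exceed (3 * (3 * b)) (fun i => block L n (n + j) i) (T * 2 ^ L).+1)).
split; first by move=> [j /= jL [i iT h]]; exists j, i.
by move=> [j [i [jL iT h]]]; exists j => //; exists i.
Qed.

Let mbad n b L : measurable (bad n b L).
Proof. by apply: bigsetU_measurable => j _; exact: measurable_exceed. Qed.

Let bad_nd n b : nondecreasing_seq (bad n b).
Proof.
apply/nondecreasing_seqP => L; apply/subsetPset => w /badE[j [i [jL iT h]]].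
apply/badE; exists j, (2 * i)%N; split; first exact: leqW.
  by rewrite expnS mulnCA leq_mul2l iT orbT.
by rewrite dyadicS.
Qed.

(** The bound on the grid is uniform in [L], so continuity of [P] from below carries it to the
    union. *)
Let bad_bound n (b : R) : 0 < b -> (P (\bigcup_L bad n b L) <= (3 * v n / b ^+ 2)%:E)%E.
Proof.
move=> b0.
have cv : P (bad n b L) @[L --> \oo] --> P (\bigcup_L bad n b L).
  by apply: nondecreasing_cvg_mu => //; exact: bigcup_measurable.
rewrite -(cvg_lim _ cv)//; apply: lime_le; first by apply/cvg_ex; eexists; exact: cv.
by apply: nearW => L; exact: exceed_grid.
Qed.

Lemma compensated_integral_uniform_cauchy :
  {ae P, forall w, forall a : R, 0 < a -> exists n, forall m, (n <= m)%N ->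
     forall k i, (i <= T * 2 ^ k)%N -> `|C (block k n m i) w| < a}.
Proof.
pose Bad p := \bigcap_n \bigcup_L bad n p.+1%:R^-1 L.
have mBadn p n : measurable (\bigcup_L bad n p.+1%:R^-1 L) by exact: bigcup_measurable.
have mBad p : measurable (Bad p) by exact: bigcapT_measurable.
have PBad p : P (Bad p) = 0%E.
  apply/eqP; rewrite eq_le measure_ge0 andbT.
  pose c : R := 3 / p.+1%:R^-1 ^+ 2.
  have le n : (P (Bad p) <= (v n * c)%:E)%E.
    apply: le_trans (_ : P (\bigcup_L bad n p.+1%:R^-1 L) <= _)%E.
      by apply: le_measure; [exact/mem_set|exact/mem_set|move=> w; apply].
    by rewrite /c mulrCA mulrA; apply: bad_bound; rewrite invr_gt0.
  have cv : (v n * c)%:E @[n --> \oo] --> (0 * c)%:E.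
    by apply: cvg_EFin; [exact: nearW|exact: cvgMr_tmp].
  rewrite mul0r in cv.
  suff : (P (Bad p) <= limn (fun n => (v n * c)%:E))%E by rewrite (cvg_lim _ cv).
  by apply: lime_ge; [apply/cvg_ex; eexists; exact: cv|exact: nearW].
have : {ae P, forall w p, ~ Bad p w}.
  apply: ae_foralln => p; exists (Bad p); split.
  - exact: mBad.
  - exact: PBad.
  - by move=> w /= /contrapT.
apply: filterS => w nB a a0.
(* The level [3 * (3 * b)] at [b = 1 / (p + 1)] is [9 / (p + 1)], which this [p] places below
   [a]. *)
pose p := Num.truncn (9 / a).
have pa : 9 * p.+1%:R^-1 < a.
  rewrite ltr_pdivrMr// mulrC -ltr_pdivrMr//.
  by rewrite truncnS_gt.
have := nB p; rewrite /Bad /bigcap /= -existsNE => -[n].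
rewrite not_implyE => -[_ nb]; exists n => m nm k i ik.
rewrite ltNge; apply/negP => h; apply: nb.
(* [L] must contain the grid of mesh [2^-k] and also reach the truncation step [m - n]. *)
pose L := maxn k (m - n).
have up l : (k <= l)%N -> exists2 i', (i' <= T * 2 ^ l)%N & dyadic l i' = dyadic k i.
  elim: l => [|l IH]; first by rewrite leqn0 => /eqP e; move: ik; rewrite e => ik; exists i.
  rewrite leq_eqVlt => /predU1P[<-|]; first by exists i.
  rewrite ltnS => /IH[i' i'l e]; exists (2 * i')%N; last by rewrite dyadicS.
  by rewrite expnS mulnCA leq_mul2l i'l orbT.
have [i' i'L e] := up L (leq_maxl _ _).
exists L => //; apply/badE; exists (m - n)%N, i'; split=> //; first exact: leq_maxr.
rewrite e subnKC//; apply: le_trans h.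
by rewrite mulrA -natrM ltW.
Qed.

End uniform_cauchy.

(** * The intensity and the ambit sets *)

Lemma measurable_lt_set d (T : measurableType d) (R : realType) (f g : T -> R) :
  measurable_fun setT f -> measurable_fun setT g -> measurable [set x | f x < g x].
Proof.
move=> mf mg; have mtrue : measurable [set true] by [].
have := measurable_fun_ltr mf mg measurableT mtrue.
by rewrite setTI.
Qed.

Lemma measurable_le_set d (T : measurableType d) (R : realType) (f g : T -> R) :
  measurable_fun setT f -> measurable_fun setT g -> measurable [set x | f x <= g x].
Proof.
move=> mf mg; have mtrue : measurable [set true] by [].
have := measurable_fun_ler mf mg measurableT mtrue.
by rewrite setTI.
Qed.

Section levy_intensity.
Context (R : realType).

(** Markov's inequality for [Num.min 1 (y ^+ 2)], which is at least [Num.min 1 (c ^+ 2)] where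
    [c < |y|]. *)
Lemma levy_tail_lty (l : {measure set R -> \bar R}) (c : R) : levy_measure l -> 0 < c ->
  (l [set y | (c < `|y|)%R] < +oo)%E.
Proof.
move=> [_ lfin] c0.
have a0 : 0 < Num.min 1 (c ^+ 2) by rewrite lt_min ltr01 exprn_gt0.
have mf : measurable_fun setT (fun y : R => (Num.min 1 (y ^+ 2))%:E).
  by apply/measurable_EFinP; apply: measurable_minr => //; exact: measurable_funX.
have ms : measurable [set y : R | c < `|y|].
  apply: measurable_lt_set => //; exact: measurableT_comp.
have := le_integral_abse l measurableT mf a0; rewrite setTI => h.
have : ((Num.min 1 (c ^+ 2))%:E * l [set y | (c < `|y|)%R] < +oo)%E.
  apply: le_lt_trans lfin.
  under eq_integral do rewrite -[_%:E]gee0_abs ?lee_fin ?le_min ?ler01 ?sqr_ge0//.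
  apply: le_trans h; apply: lee_wpmul2l; first by rewrite lee_fin ltW.
  apply: le_measure; [exact/mem_set| |].
    apply/mem_set; rewrite -[X in measurable X]setTI; apply: emeasurable_fun_le => //.
    exact: measurableT_comp.
  move=> y /= cy; rewrite lee_fin ger0_norm ?le_min ?ler01 ?sqr_ge0//.
  have cy2 : c ^+ 2 <= y ^+ 2
    by rewrite -[y ^+ 2]real_normK ?num_real// ler_pXn2r ?nnegrE ?normr_ge0// ltW.
  by rewrite !ge_min lexx cy2 orbT.
by rewrite -lte_pdivlMl// mulry gtr0_sg ?invr_gt0// mul1e.
Qed.

(** Infinite mass can accumulate only at [0], itself a null point; the tails away from it are
    finite. Product measures and Tonelli's theorem rely on this. *)
Lemma levy_sigma_finite (l : {measure set R -> \bar R}) : levy_measure l ->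
  sigma_finite setT l.
Proof.
move=> hl; have [l0 _] := hl.
exists (fun n => [set 0] `|` [set y : R | n.+1%:R^-1 < `|y|]).
  apply/esym/seteqP; split=> // y _.
  have [->|y0] := eqVneq y 0; first by exists 0%N => //; left.
  exists (Num.truncn `|y|^-1) => //; right => /=.
  rewrite invf_plt ?posrE ?normr_gt0//.
  by rewrite truncnS_gt.
move=> n.
have ms : measurable [set y : R | n.+1%:R^-1 < `|y|].
  apply: measurable_lt_set => //; exact: measurableT_comp.
split; first exact: measurableU.
apply: (@le_lt_trans _ _ (l [set 0%R] + l [set y : R | (n.+1%:R^-1 < `|y|)%R])%E).
  exact: measureU2.
by rewrite [l [set 0]]l0 add0e; apply: levy_tail_lty => //; rewrite invr_gt0.
Qed.

Variable l : {sigma_finite_measure set R -> \bar R}.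
Hypothesis levyl : levy_measure l.

(* [leb2] is built on [measurableTypeR R]; the structures below transport it to the
   canonical measurable structure of [R], with the same measurable sets. *)
Definition plane_measure : set (R * R) -> \bar R := leb2.

Let leb2' : {measure set _ -> \bar R} := (@lebesgue_measure R \x @lebesgue_measure R)%E.

Let plane_measure0 : plane_measure set0 = 0%E.
Proof. exact: (measure0 leb2'). Qed.

Let plane_measure_ge0 A : (0 <= plane_measure A)%E.
Proof. exact: (measure_ge0 leb2'). Qed.

Let plane_measure_sigma_additive : semi_sigma_additive plane_measure.
Proof. exact: (@measure_semi_sigma_additive _ _ _ leb2'). Qed.

HB.instance Definition _ := isMeasure.Build _ (R * R)%type R plane_measure
  plane_measure0 plane_measure_ge0 plane_measure_sigma_additive.

Let plane_measure_sigma_finite : sigma_finite setT plane_measure.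
Proof.
pose I n : set R := `[- n%:R, n%:R]%classic.
have mI n : measurable (I n) by exact: measurable_itv.
exists (fun n => I n `*` I n).
  apply/esym/seteqP; split=> // -[x y] _.
  have [n hn] : exists n, `|x| <= n%:R /\ `|y| <= n%:R.
    exists (maxn (Num.truncn `|x|).+1 (Num.truncn `|y|).+1).
    by split; apply: le_trans (ltW (truncnS_gt _)) _; rewrite ler_nat leq_max leqnn ?orbT.
  by exists n => //; split; rewrite /I/= in_itv/= -ler_norml; case: hn.
move=> n; split; first exact: measurableX.
have -> : plane_measure (I n `*` I n) = (lebesgue_measure (I n) * lebesgue_measure (I n))%E.
  exact: (@product_measure1E _ _ _ _ _ lebesgue_measure lebesgue_measure _ _ (mI n) (mI n)).
rewrite lebesgue_measure_itv/=; case: ifP => _; last by rewrite mul0e ltry.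
by rewrite -EFinB -EFinM ltry.
Qed.

HB.instance Definition _ := Measure_isSigmaFinite.Build _ _ _ plane_measure
  plane_measure_sigma_finite.

Definition intensity : {measure set ((R * R) * R) -> \bar R} := (plane_measure \x l)%E.

Lemma intensity_setX (B : set (R * R)) (J : set R) : measurable B -> measurable J ->
  intensity (B `*` J) = (leb2 B * l J)%E.
Proof. by move=> mB mJ; exact: product_measure1E. Qed.

Lemma integral_intensity_setX (B : set (R * R)) (J : set R) (h : R -> R) :
  measurable B -> measurable J -> measurable_fun setT h -> (forall y, 0 <= h y) ->
  (\int[intensity]_(p in B `*` J) (h p.2)%:E = leb2 B * \int[l]_(y in J) (h y)%:E)%E.
Proof.
move=> mB mJ mh h0.
have mBJ : measurable (B `*` J) by exact: measurableX.
rewrite integral_mkcond.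
have mf : measurable_fun setT ((fun p : (R * R) * R => (h p.2)%:E) \_ (B `*` J)).
  apply/(measurable_restrictT _ mBJ); apply: measurable_funTS.
  by apply/measurable_EFinP; apply: measurableT_comp => //; exact: measurable_snd.
have f0 p : (0 <= ((fun p : (R * R) * R => (h p.2)%:E) \_ (B `*` J)) p)%E.
  by rewrite patchE; case: ifP => // _; rewrite lee_fin.
apply: etrans (@fubini_tonelli1 _ _ _ _ R plane_measure l _ mf f0) _; rewrite /fubini_F.
rewrite (eq_integral (fun x => (\int[l]_(y in J) (h y)%:E) * (\1_B x)%:E)%E); last first.
  move=> x _; rewrite indicE; case: (boolP (x \in B)) => xB.
    rewrite mule1 [RHS]integral_mkcond; apply: eq_integral => y _.
    by rewrite !patchE in_setX xB.
  rewrite mule0; apply: integral0_eq => y _; by rewrite patchE in_setX (negbTE xB).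
rewrite ge0_integralZl//.
- by rewrite integral_indic// setIT muleC.
- by apply/measurable_EFinP; exact: measurable_indic.
- by apply: integral_ge0 => y _; rewrite lee_fin.
Qed.

(** Dominated convergence: a nonzero [y] eventually leaves the shrinking set, and at [0] the
    integrand vanishes. *)
Lemma cvg_levy_small (e : nat -> R) : (forall n, 0 < e n) -> e @ \oo --> 0 ->
  (\int[l]_(y in [set y | (`|y| <= e n)%R]) (Num.min 1 (y ^+ 2))%:E @[n --> \oo] --> 0)%E.
Proof.
move=> e0 ecvg.
have mf : measurable_fun setT (fun y : R => (Num.min 1 (y ^+ 2))%:E).
  by apply/measurable_EFinP; apply: measurable_minr => //; exact: measurable_funX.
have f0 (y : R) : 0 <= Num.min 1 (y ^+ 2) by rewrite le_min ler01 sqr_ge0.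
have ms n : measurable [set y : R | `|y| <= e n].
  apply: measurable_le_set => //; exact: measurableT_comp.
pose f_ n := (fun y : R => (Num.min 1 (y ^+ 2))%:E) \_ [set y | `|y| <= e n].
rewrite (_ : (fun n => _) = (fun n => \int[l]_y f_ n y)%E); last first.
  by apply/funext => n; rewrite integral_mkcond.
have := @dominated_convergence _ _ _ l setT measurableT f_ (cst 0%E)
  (fun y => (Num.min 1 (y ^+ 2))%:E).
rewrite integral0; case => //.
- by move=> n; apply/(measurable_restrictT _ (ms n)); exact: measurable_funTS.
- apply: aeW => y _; have [->|y0] := eqVneq y 0.
    rewrite (_ : f_^~ 0 = cst 0%E); first exact: cvg_cst.
    by apply/funext => n; rewrite /f_ patchE expr0n/= minEle lt_geF ?ltr01// if_same.
  apply: cvg_near_cst.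
  have : \forall n \near \oo, e n < `|y|.
    by apply: (cvgr_lt 0) => //; rewrite normr_gt0.
  apply: filterS => n ny; rewrite /f_ patchE memNset//=.
  by apply/negP; rewrite -ltNge.
- apply/integrableP; split => //.
  by under eq_integral do rewrite gee0_abs ?lee_fin//; case: levyl.
- apply: aeW => y n _; rewrite /f_ patchE; case: ifP => _; rewrite ?abse0 ?lee_fin//.
  by rewrite ger0_norm.
Qed.

End levy_intensity.

Section ambit.
Context (R : realType) (phi : R -> R).
Hypothesis phi_le : {in [set s : R | s <= 0] &, {homo phi : x y / x <= y}}.
Hypothesis phi0 : forall s : R, s <= 0 -> 0 <= phi s.
Hypothesis phi_int : (\int[lebesgue_measure]_(s in [set s : R | (s <= 0)%R]) (phi s)%:E < +oo)%E.

(** [phi] is constrained only on the nonpositive half-line; capping its argument gives a function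
    monotone, hence measurable, on the whole line. *)
Let phi1 (s : R) := phi (Num.min s 0).

Let phi1_nd : nondecreasing_fun phi1.
Proof.
move=> s t st; apply: phi_le.
- by apply/mem_set; rewrite /= ge_min lexx orbT.
- by apply/mem_set; rewrite /= ge_min lexx orbT.
- by rewrite le_min !ge_min st lexx !orbT.
Qed.

Let mphi1 : measurable_fun setT phi1.
Proof. exact: nondecreasing_measurable. Qed.

(* For [t >= 0] the ambit set at [t] is [entered t] minus the points which have left it since
   time [0]; unlike the ambit set itself, both sets increase with [t]. *)
Definition entered (t : R) : set (R * R) := [set z | z.1 < t /\ 0 < z.2 < phi (Num.min z.1 0)].

Lemma ambit_setE t : ambit_set phi t = [set z | z.1 < t /\ 0 < z.2 < phi (Num.min (z.1 - t) 0)].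
Proof.
have e (z : R * R) : z.1 < t -> Num.min (z.1 - t) 0 = z.1 - t.
  by move=> zt; apply: min_idPl; rewrite subr_le0 ltW.
by apply/seteqP; split=> z /= [zt h]; split=> //; move: h; rewrite e.
Qed.

Let msub t (f : R * R -> R) : measurable_fun setT f ->
  measurable [set z : R * R | z.1 < t /\ 0 < z.2 < phi1 (f z)].
Proof.
move=> mf.
have m1 : measurable [set z : R * R | z.1 < t] by exact: measurable_lt_set.
have m2 : measurable [set z : R * R | 0 < z.2] by exact: measurable_lt_set.
have m3 : measurable [set z : R * R | z.2 < phi1 (f z)].
  by apply: measurable_lt_set => //; exact: measurableT_comp.
rewrite (_ : [set z | _] = [set z : R * R | z.1 < t] `&` ([set z : R * R | 0 < z.2]
  `&` [set z : R * R | z.2 < phi1 (f z)])).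
  by apply: measurableI => //; exact: measurableI.
by apply/seteqP; split=> z /=; [move=> [? /andP[]]|move=> [? [? ?]]; split=> //; apply/andP].
Qed.

Lemma measurable_entered t : measurable (entered t).
Proof. by apply: msub; exact: measurable_fst. Qed.

Lemma measurable_ambit t : measurable (ambit_set phi t).
Proof.
rewrite ambit_setE; apply: (@msub t (fun z => z.1 - t)).
by apply: measurable_funB => //; exact: measurable_fst.
Qed.

Lemma entered_le s t : s <= t -> entered s `<=` entered t.
Proof. by move=> st z [zs h]; split => //; exact: lt_le_trans st. Qed.

Lemma ambit_entered t : 0 <= t -> ambit_set phi t `<=` entered t.
Proof.
move=> t0; rewrite ambit_setE => z [zt /andP[z0 h]]; split=> //; rewrite z0/=.
by apply: lt_le_trans h _; apply: phi1_nd; lra.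
Qed.

(** Points never return: since [phi] is nondecreasing, the boundary [phi (z.1 - t)] over a fixed
    abscissa can only come down as [t] grows. *)
Lemma left_le s t : 0 <= s -> s <= t ->
  entered s `\` ambit_set phi s `<=` entered t `\` ambit_set phi t.
Proof.
move=> s0 st; rewrite !ambit_setE => z [[zs /andP[z0 h]] nA].
split; first by apply: (entered_le st); split; rewrite ?z0.
move=> [_ /andP[_ h']]; apply: nA; split => //; rewrite z0/=.
by apply: lt_le_trans h' _; apply: phi1_nd; lra.
Qed.

(** The section at [s] lies in []0, phi1 s[]. Its length is integrated separately on both sides of
    [0]: below, the integral of [phi] bounds it; above, [phi 0] times the length of []0, t]]. *)
Lemma leb2_entered t : (leb2 (entered t) < +oo)%E.
Proof.
have mc a : measurable [set s : R | s <= a].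
  by apply: measurable_le_set => //; exact: measurable_cst.
apply: (@le_lt_trans _ _ (\int[lebesgue_measure]_(s in [set s : R | (s <= t)%R]) (phi1 s)%:E)%E).
  rewrite /leb2 /product_measure1 [leRHS]integral_mkcond.
  apply: ge0_le_integral => //.
  - exact: (@measurable_fun_xsection _ _ (measurableTypeR R) (measurableTypeR R) R
      (@lebesgue_measure R) (entered t) (measurable_entered t)).
  - apply/(measurable_restrictT _ (mc t)); apply: measurable_funTS; exact/measurable_EFinP.
  - move=> s _ /=; rewrite patchE; case: ifPn => [_|/negP st].
      apply: (@le_trans _ _ (lebesgue_measure `]0, phi1 s[%classic)).
        apply: le_measure.
        + by apply/mem_set; apply: measurable_xsection; exact: measurable_entered.
        + exact/mem_set.
        + by move=> x; rewrite /xsection/= => /set_mem[_ h]; rewrite in_itv/=; exact: h.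
      have : 0 <= phi1 s by rewrite phi0// ge_min lexx orbT.
      rewrite lebesgue_measure_itv/= lte_fin le_eqVlt => /predU1P[<-|->].
        by rewrite ltxx.
      by rewrite sube0.
    rewrite (_ : xsection _ s = set0) ?measure0//.
    apply/seteqP; split => // x; rewrite /xsection/= => /set_mem[st' _].
    by apply: st; apply/mem_set; exact: ltW.
have -> : [set s : R | s <= t] = ([set s : R | s <= 0] `&` [set s | s <= t])
    `|` (`]0, t]%classic).
  apply/seteqP; split=> s /=; rewrite in_itv/=; first by case: (leP s 0) => /=; [left|right; rewrite H].
  by case=> [[]//|/andP[]].
rewrite ge0_integral_setU//; last 4 first.
- by apply: measurableI; exact: mc.
- by apply: measurable_funTS; exact/measurable_EFinP.
- by move=> s _; rewrite lee_fin phi0// ge_min lexx orbT.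
- apply/disj_setPS => s [/= [s0 _]]; rewrite in_itv/= => /andP[]; lra.
apply: lte_add_pinfty.
  apply: le_lt_trans phi_int.
  apply: (@le_trans _ _ (\int[lebesgue_measure]_(s in [set s : R | (s <= 0)%R]) (phi1 s)%:E)%E).
    apply: ge0_subset_integral => //.
      by apply: measurableI; exact: mc.
      exact: mc.
      by apply: measurable_funTS; exact/measurable_EFinP.
    by move=> s _; rewrite lee_fin phi0// ge_min lexx orbT.
  rewrite le_eqVlt; apply/orP; left; apply/eqP; apply: eq_integral => s /set_mem/= s0.
  by rewrite /phi1 (min_idPl s0).
apply: (@le_lt_trans _ _ (\int[lebesgue_measure]_(s in `]0%R, t]) (phi 0)%:E)%E).
  apply: ge0_le_integral => //.
  - by move=> s _; rewrite lee_fin phi0// ge_min lexx orbT.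
  - by apply: measurable_funTS; exact/measurable_EFinP.
  - by move=> s /=; rewrite in_itv/= => /andP[s0 _]; rewrite lee_fin /phi1 (min_idPr (ltW s0)).
have lfin : (lebesgue_measure `]0%R, t] < +oo)%E.
  by rewrite lebesgue_measure_itv/=; case: ifP => _; rewrite -?EFinB ltry.
rewrite integral_cst//; apply: lte_mul_pinfty => //.
by rewrite lee_fin phi0.
Qed.

End ambit.

(** * From dyadic times to uniform convergence of cadlag paths *)

Section cadlag_ucp.
Context (R : realType).

Lemma dyadic_between (t s : R) : 0 <= t -> t < s ->
  exists k i, t < dyadic R k i /\ dyadic R k i < s.
Proof.
move=> t0 ts.
pose k := Num.truncn (s - t)^-1.
have kst : (s - t)^-1 < 2 ^+ k.+1.
  apply: lt_le_trans (truncnS_gt _) _; rewrite -natrX ler_nat.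
  exact/ltnW/ltn_expl.
have k0 : 0 < 2 ^+ k.+1 :> R by rewrite exprn_gt0.
have kinv : (2 ^+ k.+1)^-1 < s - t by rewrite invf_plt ?posrE ?subr_gt0.
exists k.+1, (Num.truncn (t * 2 ^+ k.+1)).+1; rewrite /dyadic; split.
  by rewrite ltr_pdivlMr// truncnS_gt.
rewrite ltr_pdivrMr// -natr1.
have tr : (Num.truncn (t * 2 ^+ k.+1))%:R <= t * 2 ^+ k.+1.
  by rewrite truncn_le mulr_ge0// ltW.
have : 1 < (s - t) * 2 ^+ k.+1 by rewrite -ltr_pdivrMr// div1r.
by rewrite mulrBl; lra.
Qed.

Lemma right_continuous_le (f : R -> R) (t s c : R) : 0 <= t -> t < s ->
  f x @[x --> t^'+] --> f t ->
  (forall k i, dyadic R k i < s -> `|f (dyadic R k i)| <= c) -> `|f t| <= c.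
Proof.
move=> t0 ts ft fc; rewrite leNgt; apply/negP => cf.
have fn : (fun x => `|f x|) x @[x --> t^'+] --> `|f t| by exact: cvg_norm.
move/cvgrPdist_lt : fn => /(_ (`|f t| - c)).
rewrite subr_gt0 => /(_ cf); rewrite near_withinE => -[r /= r0 h].
have [k [i [tki kis]]] : exists k i, t < dyadic R k i /\ dyadic R k i < Num.min s (t + r).
  by apply: dyadic_between => //; rewrite lt_min ts ltrDl.
move: kis; rewrite lt_min => /andP[kis kir].
have := fc _ _ kis; apply/negP; rewrite -ltNge.
have : `|t - dyadic R k i| < r by rewrite distrC ger0_norm; lra.
move=> /h /(_ tki) /=; rewrite ltr_norml; lra.
Qed.

(** A cluster point is enough to identify [x] against a uniformly Cauchy sequence: the good index
    may vary with the dyadic time, because it does not enter the final threshold [n]. *)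
Lemma cadlag_uniform_cvg (x : R -> R) (xe : nat -> R -> R) :
  cadlag x -> (forall n, cadlag (xe n)) ->
  (forall (T : nat) (a : R), 0 < a -> exists n, forall m, (n <= m)%N -> forall k i,
     (i <= T * 2 ^ k)%N -> `|xe m (dyadic R k i) - xe n (dyadic R k i)| < a) ->
  (forall k i (a : R) n, 0 < a -> exists2 m, (n <= m)%N &
     `|x (dyadic R k i) - xe m (dyadic R k i)| < a) ->
  forall T : R, 0 < T ->
    (ereal_sup [set (`| xe n t - x t |)%:E | t in [set t | (0 <= t <= T)%R]] @[n --> \oo] --> 0)%E.
Proof.
move=> cx cxe cau sub T T0.
pose u n := ereal_sup [set (`| xe n t - x t |)%:E | t in [set t | (0 <= t <= T)%R]].
have u0 n : (0 <= u n)%E.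
  apply: (@le_trans _ _ (`| xe n 0 - x 0 |)%:E); first by rewrite lee_fin.
  by apply: ereal_sup_ubound; exists 0 => //=; rewrite lexx ltW.
have small (a : R) : 0 < a -> exists n, forall m, (n <= m)%N -> (u m <= a%:E)%E.
  (* [T'] strictly exceeds [T], so that even [t = T] has dyadic times to its right in the controlled
     range. *)
  move=> a0; pose T' := (Num.truncn T).+1.
  have [n hn] := cau T' (a / 3) ltac:(by rewrite divr_gt0).
  exists n => m nm; apply: ge_ereal_sup => _ [t /= /andP[t0 tT] <-]; rewrite lee_fin.
  have tT' : t < T'%:R by apply: le_lt_trans tT _; exact: truncnS_gt.
  apply: (@right_continuous_le (fun t => xe m t - x t) t T'%:R) => //.
    by apply: cvgB; [exact: (cxe m t).1|exact: (cx t).1].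
  move=> k i kiT.
  have iT : (i <= T' * 2 ^ k)%N.
    by move: kiT; rewrite /dyadic ltr_pdivrMr ?exprn_gt0// -natrX -natrM ltr_nat => /ltnW.
  have [m' nm' hm'] := sub k i (a / 3) n ltac:(by rewrite divr_gt0).
  have h1 := hn m nm k i iT; have h2 := hn m' nm' k i iT.
  move: h1 h2 hm'.
  set p := xe m _; set q := xe n _; set r := xe m' _; set z := x _.
  have -> : p - z = (p - q) - (r - q) - (z - r) by ring.
  move=> h1 h2 h3.
  have := ler_normB (p - q - (r - q)) (z - r); have := ler_normB (p - q) (r - q); lra.
apply: cvg_EFin.
  have [n hn] := small 1 ltr01; exists n => // m /= nm.
  have h : (u m < +oo)%E by apply: le_lt_trans (hn m nm) _; rewrite ltry.
  by rewrite ge0_fin_numE; [exact: h|exact: u0].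
apply/cvgrPdist_le => a a0; have [n hn] := small a a0; exists n => // m /= nm.
have h : (u m < +oo)%E by apply: le_lt_trans (hn m nm) _; rewrite ltry.
have um0 := u0 m.
rewrite sub0r normrN ger0_norm; last exact: fine_ge0.
rewrite -lee_fin fineK; first exact: hn.
by rewrite ge0_fin_numE.
Qed.

End cadlag_ucp.

Section signed_integral.
Context (R : realType).
Local Notation S := ((R * R) * R)%type.

(* Only the values at [`|p.2| < 1] matter; capping makes the integrands bounded. *)
Definition jump_pos (p : S) : R := Num.min 1 (Num.max 0 p.2).
Definition jump_neg (p : S) : R := Num.min 1 (Num.max 0 (- p.2)).

Lemma jump_pos_ge0 p : 0 <= jump_pos p.
Proof. by rewrite le_min ler01 le_max lexx. Qed.

Lemma jump_neg_ge0 p : 0 <= jump_neg p.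
Proof. by rewrite le_min ler01 le_max lexx. Qed.

Lemma jump_pos_le1 p : jump_pos p <= 1.
Proof. by rewrite ge_min lexx. Qed.

Lemma jump_neg_le1 p : jump_neg p <= 1.
Proof. by rewrite ge_min lexx. Qed.

Lemma measurable_jump_pos : measurable_fun setT jump_pos.
Proof.
apply: measurable_minr => //; apply: measurable_maxr => //.
Qed.

Lemma measurable_jump_neg : measurable_fun setT jump_neg.
Proof.
apply: measurable_minr => //; apply: measurable_maxr => //.
exact: measurableT_comp.
Qed.

Let min1_sqr (y : R) : (Num.min 1 (Num.max 0 y)) ^+ 2 <= Num.min 1 (y ^+ 2).
Proof.
have h0 : 0 <= Num.min 1 (Num.max 0 y) by rewrite le_min ler01 le_max lexx.
have m0 : 0 <= Num.max 0 y by rewrite le_max lexx.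
rewrite le_min; apply/andP; split.
  by rewrite expr_le1// ge_min lexx.
apply: (@le_trans _ _ ((Num.max 0 y) ^+ 2)).
  by rewrite ler_pXn2r ?nnegrE// ge_min lexx orbT.
by case: (leP 0 y) => _ //; rewrite expr0n/= sqr_ge0.
Qed.

Lemma jump_pos_sqr p : jump_pos p ^+ 2 <= Num.min 1 (p.2 ^+ 2).
Proof. exact: min1_sqr. Qed.

Lemma jump_neg_sqr p : jump_neg p ^+ 2 <= Num.min 1 (p.2 ^+ 2).
Proof. by rewrite -[p.2 ^+ 2]sqrrN; exact: min1_sqr. Qed.

Lemma integral_jump (mu : {measure set S -> \bar R}) (H : set S) :
  measurable H -> (forall p, H p -> `|p.2| < 1) -> mu H \is a fin_num ->
  (\int[mu]_(p in H) (p.2)%:E =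
   (fine (\int[mu]_(p in H) (jump_pos p)%:E) - fine (\int[mu]_(p in H) (jump_neg p)%:E))%:E)%E.
Proof.
move=> mH H1 fH.
rewrite integralE EFinB !fineK; last 2 first.
- apply: integral_fin_num_le => //; [exact: measurable_jump_neg|exact: jump_neg_ge0|exact: jump_neg_le1].
- apply: integral_fin_num_le => //; [exact: measurable_jump_pos|exact: jump_pos_ge0|exact: jump_pos_le1].
congr (_ - _)%E; apply: eq_integral => p /set_mem Hp.
  rewrite funeposE /jump_pos -EFin_max; congr EFin.
  have := H1 p Hp; rewrite ltr_norml => /andP[_ p1].
  by rewrite maxC min_r// ge_max ler01 ltW.
rewrite funenegE /jump_neg -EFinN -EFin_max; congr EFin.
have := H1 p Hp; rewrite ltr_norml => /andP[p1 _].
by rewrite maxC min_r// ge_max ler01/=; lra.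
Qed.

End signed_integral.

(** * Convergence of the truncated ambit fields *)

(** In the application [x] and [y] are the positive and negative parts over the ambit set, [z] and
    [u] those over the points that have left, [c] the part common to all truncations; the sums
    [x + z] and [y + u] live on the entered region. *)
Lemma norm_four_terms_lt (R : realFieldType) (a c x x' y y' z z' u u' : R) :
  `|x + z - (x' + z')| < a / 8 + a / 8 -> `|y + u - (y' + u')| < a / 8 + a / 8 ->
  `|z - z'| < a / 8 + a / 8 -> `|u - u'| < a / 8 + a / 8 ->
  `|x - y + c - (x' - y' + c)| < a.
Proof.
rewrite !ltr_norml => /andP[? ?] /andP[? ?] /andP[? ?] /andP[? ?].
by apply/andP; split; lra.
Qed.

Section ambit_field.
Context (R : realType) (d : measure_display) (Omega : measurableType d).
Variables (P : probability Omega R) (l : {sigma_finite_measure set R -> \bar R}).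
Local Notation S := ((R * R) * R)%type.
Variable N : Omega -> {measure set S -> \bar R}.
Local Notation nu := (intensity l).
Hypotheses (levyl : levy_measure l) (prmN : poisson_random_measure P nu N).

Lemma measurable_small_jumps (eps : R) : measurable (@small_jumps R eps).
Proof.
rewrite (_ : small_jumps eps = [set y | eps < `|y|] `&` [set y | `|y| < 1]).
  by apply: measurableI; apply: measurable_lt_set => //; exact: measurableT_comp.
by apply/seteqP; split=> y /=; [move/andP|move=> ?; apply/andP].
Qed.

Lemma measurable_big_jumps : measurable (@big_jumps R).
Proof. by apply: measurable_le_set => //; exact: measurableT_comp. Qed.

Lemma measurable_integral_mark (H : set S) : measurable H ->
  measurable_fun setT (fun w => \int[N w]_(p in H) (p.2)%:E)%E.
Proof.
move=> mH.
have mpart (f : S -> R) : measurable_fun setT f ->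
    measurable_fun setT (fun w => \int[N w]_(p in H) (Num.max (f p) 0)%:E)%E.
  move=> mf; apply: measurable_integral_measures => //.
  - by apply: measurable_maxr.
  - by move=> p; rewrite le_max lexx orbT.
  - by move=> U mU _; exact: (measurable_count prmN).
rewrite (_ : (fun w => _) = (fun w => \int[N w]_(p in H) (Num.max p.2 0)%:E -
    \int[N w]_(p in H) (Num.max (- p.2) 0)%:E)%E).
  apply: emeasurable_funB; apply: mpart; first exact: measurable_snd.
  by apply: measurableT_comp => //; exact: measurable_snd.
apply/funext => w; rewrite integralE; congr (_ - _)%E; apply: eq_integral => p _.
  by rewrite funeposE -EFin_max.
by rewrite funenegE -EFinN -EFin_max.
Qed.

Lemma measurable_Lj_eps eps (B : set (R * R)) : measurable B ->
  measurable_fun setT (Lj_eps nu N eps B).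
Proof.
move=> mB; apply: emeasurable_funD.
  apply: emeasurable_funB => //; apply: measurable_integral_mark.
  by apply: measurableX => //; exact: measurable_small_jumps.
by apply: measurable_integral_mark; apply: measurableX => //; exact: measurable_big_jumps.
Qed.

Lemma intensity_small_lty (B : set (R * R)) (eps : R) : measurable B -> (leb2 B < +oo)%E ->
  0 < eps -> (nu (B `*` small_jumps eps) < +oo)%E.
Proof.
move=> mB fB e0; rewrite intensity_setX//; last exact: measurable_small_jumps.
apply: lte_mul_pinfty => //.
  by rewrite ge0_fin_numE//; exact: (measure_ge0 (@plane_measure R)).
apply: le_lt_trans (levy_tail_lty levyl e0); apply: le_measure.
- by apply/mem_set; exact: measurable_small_jumps.
- by apply/mem_set; apply: measurable_lt_set => //; exact: measurableT_comp.
- by move=> y /andP[].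
Qed.

(* Fatou along the subsequence: the [L^2] limit is an almost sure cluster point. *)
Lemma is_Lj_cluster (B : set (R * R)) (Y : Omega -> R) (e : nat -> R) :
  measurable B -> (forall n, 0 < e n) -> e @ \oo --> 0 -> is_Lj P nu N B Y ->
  {ae P, forall w (a : R) n, 0 < a -> exists2 m, (n <= m)%N &
    (`| (Y w)%:E - Lj_eps nu N (e m) B w | < a%:E)%E}.
Proof.
move=> mB e0 ecvg [mY cY].
pose f n w := ((`| (Y w)%:E - Lj_eps nu N (e n) B w |) ^+ 2)%E.
have fE n w : f n w = (`| (Y w)%:E - Lj_eps nu N (e n) B w | * `| (Y w)%:E - Lj_eps nu N (e n) B w |)%E.
  by rewrite /f expe2.
have mf n : measurable_fun setT (f n).
  have mz : measurable_fun setT (fun w => `| (Y w)%:E - Lj_eps nu N (e n) B w |)%E.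
    apply: measurableT_comp => //; apply: emeasurable_funB; first exact/measurable_EFinP.
    exact: measurable_Lj_eps.
  exact: (emeasurable_funM mz mz).
have f0 n w : (0 <= f n w)%E by rewrite fE mule_ge0.
have ce : e @ \oo --> (0 : R)^'+.
  move=> A; rewrite /at_right withinE => -[V /ecvg h VA].
  have h' : \forall n \near \oo, V (e n) := h.
  suff : \forall n \near \oo, A (e n) by [].
  apply: filterS h' => n Ven; have : (V `&` [set x | 0 < x]) (e n) by split; [|exact: e0].
  by rewrite -VA => -[].
have cf : (\int[P]_w f n w @[n --> \oo] --> 0)%E by apply: (cvg_comp _ _ ce cY).
have mlim : measurable_fun setT (fun w => limn_einf (f ^~ w)).
  apply: (emeasurable_fun_cvg _ _ (measurable_fun_einfs mf)) => w _.
  by rewrite limn_einf_lim; exact: is_cvg_einfs.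
have lim0 w : (0 <= limn_einf (f ^~ w))%E.
  rewrite limn_einf_lim; apply: lime_ge; first exact: is_cvg_einfs.
  by apply: nearW => n; apply: le_ereal_inf_tmp => _ [m _ <-].
have int0 : (\int[P]_w limn_einf (f ^~ w) = 0)%E.
  apply/eqP; rewrite eq_le; apply/andP; split; last by apply: integral_ge0.
  apply: le_trans (fatou P measurableT mf (fun n w _ => f0 n w)) _.
  by rewrite (cvg_limn_einf_sup cf).1.
have : ae_eq P setT (fun w => limn_einf (f ^~ w)) (cst 0%E).
  apply/(ae_eq_integral_abs P measurableT mlim).
  by under eq_integral do rewrite gee0_abs//.
apply: filterS => w /(_ Logic.I) /= lim_w a n a0.
(* Infima over tails increase to the lower limit, here [0], so every tail contains an index whose
   squared distance is below [a ^+ 2]. *)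
have inf0 : (ereal_inf [set f k w | k in [set k | (n <= k)%N]] < (a ^+ 2)%:E)%E.
  apply: (@le_lt_trans _ _ 0%E); last by rewrite lte_fin exprn_gt0.
  rewrite -lim_w limn_einf_lim.
  rewrite (cvg_lim _ (@cvg_einfs_sup _ (f ^~ w)))//.
  by apply: ereal_sup_ubound; exists n.
have [_ [m nm <-] h] := ereal_inf_lt inf0.
exists m => //; rewrite ltNge; apply/negP => ha; move: h; apply/negP; rewrite -leNgt fE.
by rewrite expr2 EFinM; apply: lee_pmul => //; rewrite lee_fin ltW.
Qed.

Variable phi : R -> R.
Hypothesis phi_le : {in [set s : R | s <= 0] &, {homo phi : x y / x <= y}}.
Hypothesis phi0 : forall s : R, s <= 0 -> 0 <= phi s.
Hypothesis phi_int : (\int[lebesgue_measure]_(s in [set s : R | (s <= 0)%R]) (phi s)%:E < +oo)%E.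
Variable e : nat -> R.
Hypotheses (e01 : forall n, 0 < e n < 1) (e_nincr : {homo e : m n / (m <= n)%N >-> n <= m}).
Hypothesis e_cvg : e @ \oo --> 0.

Let e_gt0 n : 0 < e n. Proof. by case/andP: (e01 n). Qed.

Local Notation K := (fun m => [set: R * R] `*` small_jumps (e m)).
Local Notation cyl B := (B `*` [set: R]).

Let mK m : measurable (K m).
Proof. by apply: measurableX => //; exact: measurable_small_jumps. Qed.

Let K_le m n : (m <= n)%N -> K m `<=` K n.
Proof.
move=> mn p [_ /= /andP[p1 p2]]; split => //=; apply/andP; split=> //.
by apply: le_lt_trans p1; exact: e_nincr.
Qed.

Let cylK (B : set (R * R)) m : cyl B `&` K m = B `*` small_jumps (e m).
Proof. by apply/seteqP; split=> p /=; [move=> [[? _] [_ ?]]|move=> [? ?]]. Qed.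

Let nu_cylK (B : set (R * R)) t m : measurable B -> B `<=` entered phi t ->
  (nu (cyl B `&` K m) < +oo)%E.
Proof.
move=> mB Bt; rewrite cylK; apply: intensity_small_lty => //.
apply: le_lt_trans (leb2_entered phi_le phi0 phi_int t).
apply: (@le_measure _ _ _ (@plane_measure R)) => //; apply/mem_set => //.
exact: measurable_entered.
Qed.

Let tail n := (\int[l]_(y in [set y | (`|y| <= e n)%R]) (Num.min 1 (y ^+ 2))%:E)%E.

Let m_min1 : measurable_fun setT (fun y : R => Num.min 1 (y ^+ 2)).
Proof. by apply: measurable_minr => //; exact: measurable_funX. Qed.

Let min1_ge0 (y : R) : 0 <= Num.min 1 (y ^+ 2).
Proof. by rewrite le_min ler01 sqr_ge0. Qed.

Let m_le n : measurable [set y : R | `|y| <= e n].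
Proof. by apply: measurable_le_set => //; exact: measurableT_comp. Qed.

Let tail_fin n : tail n \is a fin_num.
Proof.
rewrite ge0_fin_numE; last by apply: integral_ge0 => y _; rewrite lee_fin.
case: levyl => _; apply: le_lt_trans; apply: ge0_subset_integral => //.
  by apply/measurable_EFinP.
by move=> y _; rewrite lee_fin.
Qed.

(** Used with [D] the entered region and with [D] the points that have left. A mark in [K m] but not
    in [K n] has size at most [e n], so the variance is bounded by the area entered by time [T]
    times [tail n]. *)
Lemma ambit_uniform_cauchy (g : S -> R) (D : R -> set (R * R)) (T : nat) :
  measurable_fun setT g -> (forall p, 0 <= g p) -> (forall p, g p <= 1) ->
  (forall p, g p ^+ 2 <= Num.min 1 (p.2 ^+ 2)) ->
  (forall t, measurable (D t)) -> (forall t, D t `<=` entered phi t) ->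
  (forall s t, 0 <= s -> s <= t -> D s `<=` D t) ->
  {ae P, forall w, forall a : R, 0 < a -> exists n, forall m, (n <= m)%N ->
     forall k i, (i <= T * 2 ^ k)%N ->
       `|compensated_integral nu N g (cyl (D (dyadic R k i)) `&` (K m `\` K n)) w| < a}.
Proof.
move=> mg g0 g1 gsqr mD Dent D_le.
have fL : leb2 (entered phi T%:R) \is a fin_num.
  rewrite ge0_fin_numE; last exact: (measure_ge0 (@plane_measure R)).
  exact: leb2_entered.
have L0 : (0 <= leb2 (entered phi T%:R))%E by exact: (measure_ge0 (@plane_measure R)).
pose v n := fine (leb2 (entered phi T%:R)) * fine (tail n).
have tail0 n : (0 <= tail n)%E by apply: integral_ge0 => y _; rewrite lee_fin.
apply: (compensated_integral_uniform_cauchy prmN mg g0 g1 (v := v)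
  (E := fun t => cyl (D t)) (K := K)) => //.
- by move=> t; exact: measurableX.
- by move=> s t s0 st p [? ?]; split=> //; exact: (D_le s t).
- by move=> t m; apply: nu_cylK.
- move=> n m nm; rewrite /v EFinM !fineK// -integral_intensity_setX//; last exact: measurable_entered.
  have mL : measurable (entered phi T%:R `*` [set y : R | `|y| <= e n]).
    by apply: measurableX => //; exact: measurable_entered.
  have mcyl : measurable (cyl (D T%:R) `&` (K m `\` K n)).
    by apply: measurableI; [exact: measurableX|exact: measurableD].
  have m2 : measurable_fun setT (fun p : S => Num.min 1 (p.2 ^+ 2)).
    by apply: (measurableT_comp m_min1); exact: measurable_snd.
  apply: (@le_trans _ _ (\int[nu]_(p in cyl (D T%:R) `&` (K m `\` K n)) (Num.min 1 (p.2 ^+ 2))%:E)%E).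
    apply: ge0_le_integral => //.
    + by move=> p _; rewrite lee_fin sqr_ge0.
    + by apply/measurable_EFinP; apply: measurable_funX; exact: measurable_funTS.
    + by apply/measurable_EFinP; exact: measurable_funTS.
    + by move=> p _; rewrite lee_fin.
  apply: ge0_subset_integral => //.
  + by apply/measurable_EFinP; exact: measurable_funTS.
  + by move=> p _; rewrite lee_fin.
  + move=> p [[Dp _] [[_ /= /andP[_ p1]] nK]]; split; first exact: Dent.
    rewrite /= leNgt; apply/negP => ep; apply: nK; split => //=.
    by apply/andP; split.
- by move=> n; rewrite /v mulr_ge0// fine_ge0.
- rewrite -(mulr0 (fine (leb2 (entered phi T%:R)))); apply: cvgMl_tmp.
  by apply: fine_cvg; exact: cvg_levy_small.
Qed.

Local Notation C := (compensated_integral nu N).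
Local Notation net H w := (C (@jump_pos R) H w - C (@jump_neg R) H w).

Lemma Lj_eps_net eps (B : set (R * R)) w : measurable B ->
  N w (B `*` small_jumps eps) \is a fin_num -> nu (B `*` small_jumps eps) \is a fin_num ->
  Lj_eps nu N eps B w =
    ((net (B `*` small_jumps eps) w)%:E + \int[N w]_(p in B `*` big_jumps) (p.2)%:E)%E.
Proof.
move=> mB fN fnu; rewrite /Lj_eps; congr (_ + _)%E.
have mBs : measurable (B `*` small_jumps eps).
  by apply: measurableX => //; exact: measurable_small_jumps.
have lt1 (p : S) : (B `*` small_jumps eps) p -> `|p.2| < 1 by move=> [_ /= /andP[]].
rewrite !integral_jump// -EFinB; congr EFin; rewrite /compensated_integral; ring.
Qed.

(** [G] is the summand common to [X] and [Xe], zero or Gaussian; only its values at dyadic times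
    occur, and they cancel in differences. *)
Lemma ambit_ucp (X : R -> Omega -> R) (Xe : R -> R -> Omega -> R) (G : R -> Omega -> R) :
  (forall t, is_Lj P nu N (ambit_set phi t) (fun w => X t w - G t w)) ->
  (forall eps t, 0 < eps < 1 -> {ae P, forall w,
     (Xe eps t w)%:E = (Lj_eps nu N eps (ambit_set phi t) w + (G t w)%:E)%E}) ->
  (forall w, cadlag (fun t => X t w)) ->
  (forall eps w, 0 < eps < 1 -> cadlag (fun t => Xe eps t w)) ->
  as_ucp_along P X Xe e.
Proof.
move=> hX hXe cX cXe.
pose left t := entered phi t `\` ambit_set phi t.
have ment t : measurable (entered phi t) by exact: measurable_entered.
have mamb t : measurable (ambit_set phi t) by exact: measurable_ambit.
have mleft t : measurable (left t) by exact: measurableD.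
have dy0 k i : 0 <= dyadic R k i by exact: dyadic_ge0.
have cauE (g : S -> R) : measurable_fun setT g -> (forall p, 0 <= g p) -> (forall p, g p <= 1) ->
    (forall p, g p ^+ 2 <= Num.min 1 (p.2 ^+ 2)) ->
    {ae P, forall w (T : nat) (a : R), 0 < a -> exists n, forall m, (n <= m)%N ->
     forall k i, (i <= T * 2 ^ k)%N ->
       `|C g (cyl (entered phi (dyadic R k i)) `&` (K m `\` K n)) w| < a}.
  move=> mg g0 g1 gs; apply: ae_foralln => T; apply: ambit_uniform_cauchy => //.
    by move=> t; exact: subset_refl.
  by move=> s t _; exact: entered_le.
have cauL (g : S -> R) : measurable_fun setT g -> (forall p, 0 <= g p) -> (forall p, g p <= 1) ->
    (forall p, g p ^+ 2 <= Num.min 1 (p.2 ^+ 2)) ->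
    {ae P, forall w (T : nat) (a : R), 0 < a -> exists n, forall m, (n <= m)%N ->
     forall k i, (i <= T * 2 ^ k)%N ->
       `|C g (cyl (left (dyadic R k i)) `&` (K m `\` K n)) w| < a}.
  move=> mg g0 g1 gs; apply: ae_foralln => T; apply: (ambit_uniform_cauchy (D := left)) => //.
    by move=> t z [].
  by move=> s t s0 st; exact: left_le.
have fin : {ae P, forall w k i m, N w (cyl (entered phi (dyadic R k i)) `&` K m) \is a fin_num}.
  do 3 (apply: ae_foralln => ?); apply: (count_ae_fin prmN).
    by apply: measurableI => //; exact: measurableX.
  by apply: nu_cylK; [exact: ment|exact: subset_refl].
have eqXe : {ae P, forall w k i m, (Xe (e m) (dyadic R k i) w)%:E =
    (Lj_eps nu N (e m) (ambit_set phi (dyadic R k i)) w + (G (dyadic R k i) w)%:E)%E}.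
  by do 3 (apply: ae_foralln => ?); exact: hXe.
have clX : {ae P, forall w k i (a : R) n, 0 < a -> exists2 m, (n <= m)%N &
    (`| (X (dyadic R k i) w - G (dyadic R k i) w)%:E -
        Lj_eps nu N (e m) (ambit_set phi (dyadic R k i)) w | < a%:E)%E}.
  by do 2 (apply: ae_foralln => ?); apply: is_Lj_cluster.
have := cauE _ (@measurable_jump_pos R) (@jump_pos_ge0 R) (@jump_pos_le1 R) (@jump_pos_sqr R).
have := cauE _ (@measurable_jump_neg R) (@jump_neg_ge0 R) (@jump_neg_le1 R) (@jump_neg_sqr R).
have := cauL _ (@measurable_jump_pos R) (@jump_pos_ge0 R) (@jump_pos_le1 R) (@jump_pos_sqr R).
have := cauL _ (@measurable_jump_neg R) (@jump_neg_ge0 R) (@jump_neg_le1 R) (@jump_neg_sqr R).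
move=> h4 h3 h2 h1.
pose I := @filterI _ _ (ae_filter_ringOfSetsType P).
apply: filterS (I _ _ h1 (I _ _ h2 (I _ _ h3 (I _ _ h4 (I _ _ fin (I _ _ eqXe clX)))))).
move=> w [c1 [c2 [c3 [c4 [fn [eqx cl]]]]]].
have mcyl (B : set (R * R)) m : measurable B -> measurable (cyl B `&` K m).
  by move=> mB; apply: measurableI => //; exact: measurableX.
have fnB (B : set (R * R)) k i m : measurable B -> B `<=` entered phi (dyadic R k i) ->
    N w (cyl B `&` K m) \is a fin_num.
  move=> mB Bent; have := fn k i m; rewrite !ge0_fin_numE//; apply: le_lt_trans.
  apply: le_measure.
  - by apply/mem_set; exact: mcyl mB.
  - by apply/mem_set; exact: mcyl (ment (dyadic R k i)).
  - by apply: setSI => p [/Bent].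
have fnuB (B : set (R * R)) k i m : measurable B -> B `<=` entered phi (dyadic R k i) ->
    nu (cyl B `&` K m) \is a fin_num.
  by move=> mB Bent; rewrite ge0_fin_numE; [exact: nu_cylK Bent|].
have incr (g : S -> R) (B : set (R * R)) k i n m : measurable_fun setT g ->
    (forall p, 0 <= g p) -> (forall p, g p <= 1) ->
    measurable B -> B `<=` entered phi (dyadic R k i) -> (n <= m)%N ->
    C g (cyl B `&` K m) w = C g (cyl B `&` K n) w + C g (cyl B `&` (K m `\` K n)) w.
  move=> mg g0 g1 mB Bent nm.
  rewrite (_ : cyl B `&` (K m `\` K n) = (cyl B `&` K m) `\` (cyl B `&` K n)).
    apply: (compensated_integralD mg g0 g1);
      [exact: mcyl|exact: mcyl| |exact: fnB Bent|exact: fnuB Bent].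
    by apply: setIS; exact: K_le.
  apply/seteqP; split=> p; first by move=> [Bp [Kp nK]]; split => // -[].
  by move=> [[Bp Kp] nBK]; split=> //; split=> // Kn; apply: nBK.
have split (g : S -> R) k i m : measurable_fun setT g ->
    (forall p, 0 <= g p) -> (forall p, g p <= 1) ->
    C g (cyl (entered phi (dyadic R k i)) `&` K m) w =
    C g (cyl (ambit_set phi (dyadic R k i)) `&` K m) w + C g (cyl (left (dyadic R k i)) `&` K m) w.
  move=> mg g0 g1.
  rewrite (_ : cyl (left (dyadic R k i)) `&` K m = (cyl (entered phi (dyadic R k i)) `&` K m) `\`
      (cyl (ambit_set phi (dyadic R k i)) `&` K m)).
    apply: (compensated_integralD mg g0 g1);
      [exact: mcyl|exact: mcyl| |exact: fn|by apply: (fnuB _ k i); [exact: ment|exact: subset_refl]].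
    by apply: setSI => p [/ambit_entered h _]; split => //; exact: h.
  apply/seteqP; split=> p; first by move=> [[[Ep nA] _] Kp]; split => // -[[]].
  move=> [[[Ep _] Kp] nA]; split => //; split => //; split => // Ap.
  by apply: nA.
have ambent k i : ambit_set phi (dyadic R k i) `<=` entered phi (dyadic R k i).
  exact: ambit_entered.
(* [c] collects the big-jump integral and [G]. An infinite big-jump integral would contradict [eqx],
   whose left side is a real number. *)
have XeE k i : exists c : R, forall m, Xe (e m) (dyadic R k i) w =
    net (cyl (ambit_set phi (dyadic R k i)) `&` K m) w + c.
  have LE m := @Lj_eps_net (e m) (ambit_set phi (dyadic R k i)) w (mamb _).
  have LE' m : Lj_eps nu N (e m) (ambit_set phi (dyadic R k i)) w =
      ((net (cyl (ambit_set phi (dyadic R k i)) `&` K m) w)%:E +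
       \int[N w]_(p in ambit_set phi (dyadic R k i) `*` big_jumps) (p.2)%:E)%E.
    by rewrite LE -cylK//; [exact: fnB (ambent k i)|exact: fnuB (ambent k i)].
  move: LE'; case: (\int[N w]_(p in ambit_set phi (dyadic R k i) `*` big_jumps) (p.2)%:E)%E
    => [c||] LE'.
  - exists (c + G (dyadic R k i) w) => m.
    by apply: EFin_inj; rewrite eqx LE' -!EFinD addrA.
  - by have := eqx k i 0%N; rewrite LE'.
  - by have := eqx k i 0%N; rewrite LE'.
apply: cadlag_uniform_cvg => //.
- by move=> n; exact: cXe.
- move=> T a a0.
  have b0 : 0 < a / 8 by rewrite divr_gt0.
  have [n1 H1] := c1 T _ b0; have [n2 H2] := c2 T _ b0.
  have [n3 H3] := c3 T _ b0; have [n4 H4] := c4 T _ b0.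
  pose n := maxn (maxn n1 n2) (maxn n3 n4).
  have [l1 l2 l3 l4] : [/\ (n1 <= n)%N, (n2 <= n)%N, (n3 <= n)%N & (n4 <= n)%N].
    by rewrite /n !leq_max !leqnn !orbT.
  exists n => m nm k i ik; have [c Xc] := XeE k i; rewrite !Xc.
  (* The available blocks start at their own threshold [n'] rather than at [n]; comparing levels [m]
     and [n] through [n'] costs two blocks, hence [a / 8] twice. *)
  have osc (g : S -> R) B n' : measurable_fun setT g ->
      (forall p, 0 <= g p) -> (forall p, g p <= 1) ->
      measurable B -> B `<=` entered phi (dyadic R k i) -> (n' <= n)%N ->
      (forall m, (n' <= m)%N -> `|C g (cyl B `&` (K m `\` K n')) w| < a / 8) ->
      `|C g (cyl B `&` K m) w - C g (cyl B `&` K n) w| < a / 8 + a / 8.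
    move=> mg g0 g1 mB Bent n'n hn'.
    have := hn' m (leq_trans n'n nm); have := hn' n n'n.
    rewrite (@incr g B k i n' m)//; last exact: leq_trans nm.
    rewrite (@incr g B k i n' n)// opprD addrACA subrr add0r => p1 p2.
    by apply: le_lt_trans (ler_normB _ _) _; exact: ltrD.
  have o1 := osc _ (entered phi (dyadic R k i)) n1 (@measurable_jump_pos R) (@jump_pos_ge0 R)
    (@jump_pos_le1 R) (ment _) (@subset_refl _ _) l1 (fun m h => H1 m h k i ik).
  have o2 := osc _ (entered phi (dyadic R k i)) n2 (@measurable_jump_neg R) (@jump_neg_ge0 R)
    (@jump_neg_le1 R) (ment _) (@subset_refl _ _) l2 (fun m h => H2 m h k i ik).
  have o3 := osc _ (left (dyadic R k i)) n3 (@measurable_jump_pos R) (@jump_pos_ge0 R)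
    (@jump_pos_le1 R) (mleft _) (@subDsetl _ _ _) l3 (fun m h => H3 m h k i ik).
  have o4 := osc _ (left (dyadic R k i)) n4 (@measurable_jump_neg R) (@jump_neg_ge0 R)
    (@jump_neg_le1 R) (mleft _) (@subDsetl _ _ _) l4 (fun m h => H4 m h k i ik).
  move: o1 o2 o3 o4.
  have sp j := @split _ k i j (@measurable_jump_pos R) (@jump_pos_ge0 R) (@jump_pos_le1 R).
  have sn j := @split _ k i j (@measurable_jump_neg R) (@jump_neg_ge0 R) (@jump_neg_le1 R).
  by rewrite !sp !sn; exact: norm_four_terms_lt.
- move=> k i a n a0; have [m nm h] := cl k i a n a0; exists m => //.
  move: h (eqx k i m); case: (Lj_eps _ _ _ _ _) => [r||] //=.
  rewrite lte_fin -EFinD => h [->].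
  by rewrite opprD addrA addrAC.
Qed.

End ambit_field.

(** * Lévy measures as sigma-finite measures, and the conclusion *)

Section sigma_finite_levy.
Context (R : realType) (l : {measure set R -> \bar R}) (levyl : levy_measure l).

(* The proof of [levy_measure l] is a phantom argument, on which the sigma-finite instance
   is declared. *)
Definition sigma_finite_levy (_ : levy_measure l) : set R -> \bar R := l.

Let levy0 : sigma_finite_levy levyl set0 = 0%E. Proof. exact: (measure0 l). Qed.
Let levy_ge0 A : (0 <= sigma_finite_levy levyl A)%E. Proof. exact: (measure_ge0 l). Qed.
Let levy_sigma_additive : semi_sigma_additive (sigma_finite_levy levyl).
Proof. exact: (@measure_semi_sigma_additive _ _ _ l). Qed.

HB.instance Definition _ := isMeasure.Build _ R R (sigma_finite_levy levyl)
  levy0 levy_ge0 levy_sigma_additive.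
HB.instance Definition _ := Measure_isSigmaFinite.Build _ R R (sigma_finite_levy levyl)
  (levy_sigma_finite levyl).

End sigma_finite_levy.

Theorem theorem3p4 (R : realType) (d : measure_display) (Omega : measurableType d)
  (P : probability Omega R) (l : {measure set R -> \bar R})
  (N : Omega -> {measure set ((R * R) * R) -> \bar R}) (phi : R -> R) :
  levy_measure l ->
  poisson_random_measure P (levy_intensity l) N ->
  {within [set s : R | s <= 0], continuous phi} ->
  {in [set s : R | s <= 0] &, {homo phi : x y / x <= y}} ->
  (forall s, s <= 0 -> 0 <= phi s) ->
  (\int[lebesgue_measure]_(s in [set s : R | (s <= 0)%R]) (phi s)%:E < +oo)%E ->
  (* jump part only *)
  (forall (X : R -> Omega -> R) (Xe : R -> R -> Omega -> R),
     (forall t, is_Lj P (levy_intensity l) N (ambit_set phi t) (X t)) ->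
     (forall eps t, 0 < eps < 1 ->
        {ae P, forall w, (Xe eps t w)%:E = Lj_eps (levy_intensity l) N eps (ambit_set phi t) w}) ->
     (forall w, cadlag (fun t => X t w)) ->
     (forall eps w, 0 < eps < 1 -> cadlag (fun t => Xe eps t w)) ->
     forall e : nat -> R, (forall n, 0 < e n < 1) ->
       {homo e : m n / (m <= n)%N >-> n <= m} -> e @ \oo --> 0 ->
       as_ucp_along P X Xe e) /\
  (* with an independent Gaussian Levy basis added *)
  (forall (xi a : R) (Lg : set (R * R) -> Omega -> R),
     gaussian_levy_basis P xi a Lg -> independent_of_prm P Lg N ->
     forall (X : R -> Omega -> R) (Xe : R -> R -> Omega -> R),
     (forall t, is_Lj P (levy_intensity l) N (ambit_set phi t)
                  (fun w => X t w - Lg (ambit_set phi t) w)) ->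
     (forall eps t, 0 < eps < 1 ->
        {ae P, forall w, (Xe eps t w)%:E =
           (Lj_eps (levy_intensity l) N eps (ambit_set phi t) w
            + (Lg (ambit_set phi t) w)%:E)%E}) ->
     (forall w, cadlag (fun t => X t w)) ->
     (forall eps w, 0 < eps < 1 -> cadlag (fun t => Xe eps t w)) ->
     forall e : nat -> R, (forall n, 0 < e n < 1) ->
       {homo e : m n / (m <= n)%N >-> n <= m} -> e @ \oo --> 0 ->
       as_ucp_along P X Xe e).
Proof.
move=> levyl prmN _ phi_le phi_ge0 phi_int.
(* [intensity l'] unfolds to [levy_intensity l], so the hypotheses on the latter apply by
   conversion. *)
pose l' : {sigma_finite_measure set R -> \bar R} := sigma_finite_levy levyl; split.
  move=> X Xe LX LXe cX cXe e e01 e_le e_cvg.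
  apply: (@ambit_ucp _ _ _ P l' N levyl prmN phi phi_le phi_ge0 phi_int e e01 e_le e_cvg
    X Xe (fun _ _ => 0)) => //.
    by move=> t; under eq_fun do rewrite subr0; exact: LX.
  by move=> eps t eps01; apply: filterS (LXe eps t eps01) => w ->; rewrite adde0.
move=> xi a Lg _ _ X Xe LX LXe cX cXe e e01 e_le e_cvg.
exact: (@ambit_ucp _ _ _ P l' N levyl prmN phi phi_le phi_ge0 phi_int e e01 e_le e_cvg
  X Xe (fun t w => Lg (ambit_set phi t) w)).
Qed.
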